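(* Let $A$ be an integer $d\times n$ matrix with columns $a_1,\dots,a_n\in\mathbb{Z}^d$ and $\operatorname{rank}A=d<n$, let $b\in\mathbb{Z}^d$, and let $P=\{x\in\mathbb{R}^n: Ax=b,\ x\ge0\}$ be bounded and contain a point all of whose coordinates are strictly positive. Assume $A(\mathbb{Z}^n)=\mathbb{Z}^d$. Let $z=(\zeta_1,\dots,\zeta_n)$ be the unique point of $P$ maximizing $$g(x)=\sum_{j=1}^n\Big((\xi_j+1)\ln(\xi_j+1)-\xi_j\ln\xi_j\Big),\qquad x=(\xi_1,\dots,\xi_n),$$ and let $B$ be the $d\times n$ matrix whose $j$-th column is $(\zeta_j^2+\zeta_j)^{1/2}a_j$. Let $q:\mathbb{R}^d\to\mathbb{R}$, $q(t)=\frac12\sum_{j=1}^n(\zeta_j+\zeta_j^2)\langle a_j,t\rangle^2$. For $i=1,\dots,d$ let $Y_i\subset\mathbb{Z}^n$ be a non-empty finite set with $Ay=e_i$ for all $y\in Y_i$, and let $\psi_i:\mathbb{R}^n\to\mathbb{R}$, $\psi_i(x)=\frac{1}{|Y_i|}\sum_{y\in Y_i}\langle y,x\rangle^2$. Suppose that for some $\lambda\ge0$ we have $q(t)\ge\lambda\|t\|^2$ for all $t\in\mathbb{R}^d$; that for some $\rho>0$ we have $\psi_i(x)\le\rho\|x\|^2$ for all $x\in\mathbb{R}^n$ and $i=1,\dots,d$; that for some $\theta\ge1$ we have $\|a_j\|_1\le\theta\sqrt{\zeta_j/(1+\zeta_j)^3}$ for $j=1,\dots,n$; and that $\zeta_j(1+\zeta_j)\ge\alpha$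 for $j=1,\dots,n$ and some $\alpha\ge0$. Then there is an absolute constant $\gamma>0$ such that for any $0<\epsilon\le1/2$, as long as $$\lambda\ge\gamma\epsilon^{-2}\theta^2\Big(d+\ln\frac1\epsilon\Big)^2\ln\Big(\frac n\epsilon\Big),$$ we have $$|P\cap\mathbb{Z}^n|=e^{g(z)}\left(\frac{\kappa}{(2\pi)^{d/2}(\det BB^T)^{1/2}}+\Delta\right)$$ where $1-\epsilon\le\kappa\le1+\epsilon$ and $|\Delta|\le\left(1+\frac25\alpha\pi^2\right)^{-m}$ with $m=\left\lfloor\frac{1}{16\pi^2\rho\theta^2}\right\rfloor$.
   Context: $e_1,\dots,e_d$ is the standard basis of $\mathbb{Z}^d$. $\langle\cdot,\cdot\rangle$ is the standard scalar product, $\|\cdot\|$ the Euclidean norm, and $\|t\|_1=\sum_i|\tau_i|$ the $\ell^1$ norm. The function $g$ is strictly concave on the non-negative orthant, so its maximizer on $P$ is unique. *)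

(* Defs.v *)
From HB Require Import structures.
From mathcomp Require Import all_boot all_order all_algebra finmap.
From mathcomp Require Import all_classical all_reals all_analysis.

Set Implicit Arguments.
Unset Strict Implicit.
Unset Printing Implicit Defensive.

Import Order.TTheory GRing.Theory Num.Theory.
Import numFieldNormedType.Exports.

Local Open Scope classical_set_scope.
Local Open Scope ring_scope.

Section Defs.
Context {R : realType}.

Definition mxR {m n : nat} (M : 'M[int]_(m, n)) : 'M[R]_(m, n) :=
  map_mx intr M.

Definition dotv {n : nat} (u v : 'cV[R]_n) : R := \sum_(i < n) u i 0 * v i 0.

(* The library norm on 'cV[R]_n is the sup norm. *)
Definition enorm {n : nat} (x : 'cV[R]_n) : R := Num.sqrt (dotv x x).

Definition norm1 {n : nat} (x : 'cV[R]_n) : R := \sum_(i < n) `|x i 0|.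

Definition polyhedron {d n : nat} (A : 'M[int]_(d, n)) (b : 'cV[int]_d) :
    set 'cV[R]_n :=
  [set x | mxR A *m x = mxR b /\ forall j, 0 <= x j 0].

(* The count is meaningful only when the set of integer points is finite
   (e.g. for bounded P); fset_set is empty otherwise. *)
Definition nb_int_points {n : nat} (P : set 'cV[R]_n) : nat :=
  #|` fset_set [set x : 'cV[int]_n | P (mxR x)]|.

(* ln 0 = 0 in the library, so the summand is 0 at xi_j = 0, its limit. *)
Definition entropy {n : nat} (x : 'cV[R]_n) : R :=
  \sum_(j < n)
    ((x j 0 + 1) * ln (x j 0 + 1) - x j 0 * ln (x j 0)).

Definition maximizes {n : nat} (g : 'cV[R]_n -> R) (P : set 'cV[R]_n)
    (z : 'cV[R]_n) : Prop :=
  P z /\ forall x, P x -> g x <= g z.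

Definition scaledmx {d n : nat} (A : 'M[int]_(d, n)) (z : 'cV[R]_n) :
    'M[R]_(d, n) :=
  \matrix_(i, j) (Num.sqrt (z j 0 ^+ 2 + z j 0) * mxR A i j).

Definition qform {d n : nat} (A : 'M[int]_(d, n)) (z : 'cV[R]_n)
    (t : 'cV[R]_d) : R :=
  2^-1 * \sum_(j < n)
    (z j 0 + z j 0 ^+ 2) * dotv (col j (mxR A)) t ^+ 2.

Definition psi {n : nat} (Y : {fset 'cV[int]_n}) (x : 'cV[R]_n) : R :=
  (#|` Y|%:R)^-1 * \sum_(y <- Y) dotv (mxR y) x ^+ 2.

End Defs.

(* Main.v *)
(** Let X have independent geometric coordinates with means z_j. Since z
    maximizes the entropy, X has mass exp (- entropy z) at every integer point
    of P, so the count is exp (entropy z) * Pr (A X = b). Instead of inverting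
    the characteristic function F of A X by an integral over a cube, we sum F
    over the grid of mesh 2 pi / N: geometric series are exact there, so this
    finite Fourier inversion returns Pr (A X = b mod N), which tends to
    Pr (A X = b). The Gaussian exp (- q) is summed over the same grid; one
    variable at a time (Schur complements), its grid sums tend to
    (2 pi)^(d/2) / sqrt (det B B^T), uniformly under translation, so no
    multidimensional integral is needed.

    Pointwise, F is compared with exp (- q) by a bound valid on the whole grid:
    a factor eps where q and the coordinates are small, exponentially tilted
    Gaussians where some coordinate is large, exp (- q / 4) where q is large,
    and, where some |t_i| >= 1 / (2 theta), a constant which is the error term
    Delta: there the vectors of Y_i keep A^T t away from 2 pi Z^n. *)

Require Import Defs.
From HB Require Import structures.
From mathcomp Require Import all_boot all_order all_algebra finmap.
From mathcomp Require Import all_classical all_reals all_analysis.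
From mathcomp Require Import measurable_realfun complex.
From mathcomp Require Import ring lra zify.
Import Order.TTheory GRing.Theory Num.Theory.
Import numFieldNormedType.Exports.
Local Open Scope classical_set_scope.
Local Open Scope ring_scope.
Set Implicit Arguments.
Unset Strict Implicit.
Unset Printing Implicit Defensive.

(** * Gaussian sums over one-dimensional grids *)

Section GaussianSums.
Context {R : realType}.
Implicit Types (a h c : R).
Local Notation mu := (@lebesgue_measure R).

(** Every majorant in the pointwise bound is a constant or, up to a scalar, a translated or widened
    Gaussian. So no region of the cube has to be measured: the limit of Gaussian grid sums serves
    for all of them. The translates come from tilting, since exp (- q(t) + eta t_i) is a multiple of
    a shifted exp (- q).

    The hypothesis on lambda is the price of two thresholds. The function exp (- q / 4) has 2^d
    times the mass of exp (- q), so the threshold K for q must make exp (- K / 4) beat 2^d / eps: K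
    is of order d + ln (1 / eps). The 2 d tilts cost 2 d exp (- lambda s0^2), so the threshold s0
    for the coordinates is of order sqrt (ln (n / eps) / lambda). Where neither is exceeded, F
    differs from exp (- q) by a relative error of order K theta s0; asking this to be of order eps,
    and squaring, gives the stated bound on lambda.

    F is centered, as the characteristic function of A (X - z) = A X - b: the first-order phase
    disappears, and a plain sum of F over the grid computes the probability at b. *)

Lemma integral_gaussian a : 0 < a ->
  (\int[mu]_x (expR (- (a / 2 * x ^+ 2)))%:E = (Num.sqrt (2 * pi / a))%:E)%E.
Proof.
move=> a0; set s := (Num.sqrt a)^-1.
have s0 : s != 0 by rewrite invr_eq0 gt_eqF// sqrtr_gt0.
have s2 : s ^+ 2 = a^-1 by rewrite exprVn sqr_sqrtr// ltW.
have p0 := @normal_peak_gt0 R _ s0.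
have := @integral_normal_pdf R 0 s.
under eq_integral => x _ do rewrite normal_pdfE// EFinM.
rewrite ge0_integralZl_EFin//; last 3 first.
- by move=> x _; rewrite lee_fin normal_fun_ge0.
- by apply/measurable_EFinP; exact: measurable_normal_fun.
- exact: ltW.
have -> : (fun x => (normal_fun 0 s x)%:E) = (fun x : R => (expR (- (a / 2 * x ^+ 2)))%:E).
  apply/funext => x; rewrite /normal_fun s2 subr0; congr (expR _)%:E.
  by field; rewrite gt_eqF.
move=> /(congr1 (fun y => ((normal_peak s)^-1)%:E * y)%E).
rewrite muleA -EFinM mulVf ?gt_eqF// mul1e mule1 => ->.
rewrite /normal_peak invrK s2; congr (Num.sqrt _)%:E.
by rewrite -mulr_natl mulrA mulrAC.
Qed.

Lemma floor_cell h c x (k : int) : 0 < h ->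
  (x \in `[h * k%:~R + c, h * k%:~R + c + h[) = (Num.floor ((x - c) / h) == k).
Proof.
move=> h0; rewrite in_itv/= -[RHS]/(_ == _).
rewrite floor_eq.
rewrite ler_pdivlMr// ltr_pdivrMr// lerBrDr ltrBlDr intrD mulrDl mul1r.
by rewrite (mulrC h) (addrAC _ c).
Qed.

(** Countable additivity of the integral concerns sequences of sets; the cells indexed by [int] are
    re-indexed along this enumeration. *)
Definition nat_to_int (n : nat) : int := if odd n then Negz n./2 else Posz n./2.

Lemma nat_to_int_bij : set_bij [set: nat] [set: int] nat_to_int.
Proof.
split=> //.
  move=> m n _ _; rewrite /nat_to_int.
  case om: (odd m); case on: (odd n) => // -[] e;
    by rewrite -(odd_double_half m) -(odd_double_half n) om on e.
move=> [k|k] _ /=.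
  by exists k.*2 => //; rewrite /nat_to_int odd_double doubleK.
by exists k.*2.+1 => //; rewrite /nat_to_int/= odd_double/= uphalf_double.
Qed.

Lemma integral_cells h c (f : R -> \bar R) : 0 < h ->
  measurable_fun setT f -> (forall x, 0 <= f x)%E ->
  (\int[mu]_x f x = \esum_(k in [set: int])
     \int[mu]_(x in `[(h * k%:~R + c)%R, (h * k%:~R + c + h)%R[) f x)%E.
Proof.
move=> h0 mf f0.
rewrite (@reindex_esum R nat int setT setT nat_to_int _ nat_to_int_bij)//.
rewrite -nneseries_esumT; last by move=> n; exact: integral_ge0.
pose F (n : nat) : set R := [set` `[h * (nat_to_int n)%:~R + c,
  (h * (nat_to_int n)%:~R + c + h)%R[].
have UF : \bigcup_k F k = [set: R].
  apply/seteqP; split=> // x _.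
  have [_ _ /(_ (Num.floor ((x - c) / h)) I)[n _ nE]] := nat_to_int_bij.
  by exists n => //; rewrite /F /= floor_cell// nE.
rewrite -UF ge0_integral_bigcup//.
- by move=> k; exact: measurable_itv.
- exact: measurable_funTS.
- apply/trivIsetP => i j _ _ ij; apply/seteqP; split => // x [].
  rewrite /F /= !floor_cell// => /eqP -> /eqP.
  have [_ /(_ i j) inj _] := nat_to_int_bij.
  by move=> /inj ij'; rewrite ij' ?inE// eqxx in ij.
Qed.

Lemma esumZl (T : choiceType) (I : set T) (a : R) (f : T -> \bar R) :
  0 <= a -> (forall i, 0 <= f i)%E ->
  (\esum_(i in I) (a%:E * f i) = a%:E * \esum_(i in I) f i)%E.
Proof.
move=> a0 f0; rewrite /esum -ereal_supZl//; last first.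
  by apply/set0P; exists 0%E; exists set0; [exact: fsets_set0|rewrite fsbig_set0].
congr ereal_sup; apply/seteqP; split=> y.
  move=> [X IX <-]; exists (\sum_(i \in X) f i)%E; first by exists X.
  by rewrite ge0_mule_fsumr.
by move=> [_ [X IX <-] <-]; exists X => //; rewrite ge0_mule_fsumr.
Qed.

(* Comparing with Gaussians of slightly different variance, rather than by
   monotonicity, gives bounds that do not depend on the offset of the grid. *)
Lemma gauss_cell_bounds a h t x : 0 < a -> 0 < h -> h <= 1 -> t <= x < t + h ->
  expR (- (a * h)) * expR (- (a * (1 + h) / 2 * x ^+ 2)) <= expR (- (a / 2 * t ^+ 2))
  <= expR (a * h / 2) * expR (- (a * (1 - h) / 2 * x ^+ 2)).
Proof.
move=> a0 h0 h1 /andP[tx xt].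
rewrite -!expRD !ler_expR.
set y := x - t; have -> : t = x - y by rewrite /y; ring.
have y0 : 0 <= y by rewrite subr_ge0.
have yh : y <= h by rewrite /y; lra.
(* Both bounds rest on [2 * |x| * y <= y * (x ^+ 2 + 1)] with [0 <= y <= h]; the upper one also uses
   [y ^+ 2 <= y]. *)
have H1 : (x - y) ^+ 2 <= (1 + h) * x ^+ 2 + 2 * h.
  have : 0 <= y * (x + 1) ^+ 2 by rewrite mulr_ge0 ?sqr_ge0.
  have : 0 <= (h - y) * (x ^+ 2 + 1) by rewrite mulr_ge0 ?subr_ge0 ?addr_ge0 ?sqr_ge0.
  have : 0 <= y * (1 - y) by rewrite mulr_ge0 // subr_ge0 (le_trans yh).
  nra.
have H2 : (1 - h) * x ^+ 2 - h <= (x - y) ^+ 2.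
  have : 0 <= y * (x - 1) ^+ 2 by rewrite mulr_ge0 ?sqr_ge0.
  have : 0 <= (h - y) * (x ^+ 2 + 1) by rewrite mulr_ge0 ?subr_ge0 ?addr_ge0 ?sqr_ge0.
  have := sqr_ge0 y.
  nra.
apply/andP; split; nra.
Qed.

Let measurable_gauss (a : R) (D : set R) :
  measurable_fun D (fun x : measurableTypeR R => (expR (- (a / 2 * x ^+ 2)))%:E).
Proof.
apply: measurable_funTS; apply/measurable_EFinP; apply: measurableT_comp => //.
apply: measurableT_comp => //; apply: measurable_funM => //.
Qed.

Lemma integral_gauss_cells a h c : 0 < a -> 0 < h ->
  (\esum_(k in [set: int])
     \int[mu]_(x in `[(h * k%:~R + c)%R, (h * k%:~R + c + h)%R[)
        (expR (- (a / 2 * x ^+ 2)))%:E = (Num.sqrt (2 * pi / a))%:E)%E.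
Proof.
move=> a0 h0; rewrite -(@integral_cells h c (fun x => (expR (- (a / 2 * x ^+ 2)))%:E)) ?integral_gaussian//.
Qed.

Lemma integral_cell_cst h t (r : R) : 0 < h ->
  (\int[mu]_(x in `[t, (t + h)%R[) r%:E = (h * r)%:E)%E.
Proof.
move=> h0; rewrite integral_cst//= lebesgue_measure_itv/= lte_fin ltrDl h0.
by rewrite -EFinD -EFinM mulrC; congr (_ * _)%:E; ring.
Qed.

(** Each term is the integral of a constant over a cell of length h, and [gauss_cell_bounds]
    compares this constant with two Gaussians on the cell. Summed over all cells, these become full
    Gaussian integrals with a replaced by [a * (1 + h)] and [a * (1 - h)]. *)
Lemma gauss_esum1_bounds a h c : 0 < a -> 0 < h -> h < 1 ->
  ((expR (- (a * h)) * Num.sqrt (2 * pi / (a * (1 + h))))%:E <=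
   \esum_(k in [set: int]) (h * expR (- (a / 2 * (h * k%:~R + c) ^+ 2)))%:E <=
   (expR (a * h / 2) * Num.sqrt (2 * pi / (a * (1 - h))))%:E)%E.
Proof.
move=> a0 h0 h1.
have ap : 0 < a * (1 + h) by rewrite mulr_gt0// addr_gt0.
have am : 0 < a * (1 - h) by rewrite mulr_gt0// subr_gt0.
rewrite [X in (X <= _ <= _)%E]EFinM [X in (_ <= _ <= X)%E]EFinM.
rewrite -(integral_gauss_cells c ap h0) -(integral_gauss_cells c am h0).
rewrite -!esumZl ?expR_ge0//; try by move=> i; apply: integral_ge0 => x _; rewrite lee_fin expR_ge0.
apply/andP; split; apply: le_esum => k _; rewrite -(integral_cell_cst (h * k%:~R + c)) //;
  rewrite -ge0_integralZl_EFin ?expR_ge0//; try (by move=> x _; rewrite lee_fin expR_ge0).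
- apply: ge0_le_integral => //.
  + by apply: measurable_funeM; exact: measurable_gauss.
  + by move=> x; rewrite /= in_itv/= -EFinM lee_fin => /(gauss_cell_bounds a0 h0 (ltW h1))/andP[].
- exact: measurable_gauss.
- apply: ge0_le_integral => //.
  + by apply: measurable_funeM; exact: measurable_gauss.
  + by move=> x; rewrite /= in_itv/= -EFinM lee_fin => /(gauss_cell_bounds a0 h0 (ltW h1))/andP[].
- exact: measurable_gauss.
Qed.

(** The outer bounds of [gauss_esum1_bounds] do not involve c, so one threshold on h serves all
    offsets. The induction on the dimension needs this order of quantifiers. *)
Lemma gauss_esum1_near a e : 0 < a -> 0 < e ->
  \forall h \near 0^'+, forall c,
  ((Num.sqrt (2 * pi / a) - e)%:E <=
   \esum_(k in [set: int]) (h * expR (- (a / 2 * (h * k%:~R + c) ^+ 2)))%:E <=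
   (Num.sqrt (2 * pi / a) + e)%:E)%E.
Proof.
move=> a0 e0.
have L : expR (- (a * h)) * Num.sqrt (2 * pi / (a * (1 + h))) @[h --> 0^'+] -->
   expR (- (a * 0)) * Num.sqrt (2 * pi / (a * (1 + 0))).
  apply: cvg_at_right_filter; apply: cvgM.
    apply: continuous_cvg; first exact: continuous_expR.
    by apply: cvgN; apply: cvgM; [exact: cvg_cst|exact: cvg_id].
  apply: continuous_cvg; first exact: sqrt_continuous.
  apply: cvgM; first exact: cvg_cst.
  apply: cvgV; first by rewrite addr0 mulr1 gt_eqF.
  by apply: cvgM; [exact: cvg_cst|apply: cvgD; [exact: cvg_cst|exact: cvg_id]].
rewrite mulr0 oppr0 expR0 mul1r addr0 mulr1 in L.
have U : expR (a * h / 2) * Num.sqrt (2 * pi / (a * (1 - h))) @[h --> 0^'+] -->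
   expR (a * 0 / 2) * Num.sqrt (2 * pi / (a * (1 - 0))).
  apply: cvg_at_right_filter; apply: cvgM.
    apply: continuous_cvg; first exact: continuous_expR.
    by apply: cvgM; [apply: cvgM; [exact: cvg_cst|exact: cvg_id]|exact: cvg_cst].
  apply: continuous_cvg; first exact: sqrt_continuous.
  apply: cvgM; first exact: cvg_cst.
  apply: cvgV; first by rewrite subr0 mulr1 gt_eqF.
  by apply: cvgM; [exact: cvg_cst|apply: cvgB; [exact: cvg_cst|exact: cvg_id]].
rewrite mulr0 mul0r expR0 mul1r subr0 mulr1 in U.
near=> h => c.
have h0 : 0 < h by [].
have h1 : h < 1 by near: h; exact: nbhs_right_lt.
have /andP[l u] := gauss_esum1_bounds c a0 h0 h1.
apply/andP; split.
  apply: le_trans l; rewrite lee_fin; apply: ltW; near: h.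
  by apply: (cvgr_gt _ L); rewrite ltrBlDr ltrDl.
apply: (le_trans u); rewrite lee_fin; apply: ltW; near: h.
by apply: (cvgr_lt _ U); rewrite ltrDl.
Unshelve. all: by end_near. Qed.

End GaussianSums.

(** * Gaussian sums over grids in dimension d *)

Section QuadraticGaussianSums.
Context {R : realType}.

Definition qf d (Q : 'M[R]_d) (t : 'cV[R]_d) : R := (t^T *m Q *m t) 0 0.

Definition posdefmx d (Q : 'M[R]_d) : Prop :=
  Q^T = Q /\ forall t, t != 0 -> 0 < qf Q t.

(** Closed form of the integral of [expR (- (qf Q t / 2))] over the whole space; here it only serves
    as the limit of grid sums. *)
Definition gauss_mass d (Q : 'M[R]_d) : R := Num.sqrt ((2 * pi) ^+ d / \det Q).

Lemma row_col_scalar d (r : 'rV[R]_d) (t : 'cV[R]_d) : r *m t = ((r *m t) 0 0)%:M.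
Proof. by apply/matrixP => i j; rewrite !ord1 [RHS]mxE mulr1n. Qed.

Section Schur.
Variables (d : nat) (Q : 'M[R]_(1 + d)).
Hypothesis pdQ : posdefmx Q.

Let a := Q 0 0.
Let r : 'rV[R]_d := ursubmx Q.

Definition schurmx : 'M[R]_d := drsubmx Q - a^-1 *: (r^T *m r).

Let QE : Q = block_mx a%:M r r^T (drsubmx Q).
Proof.
rewrite -[LHS]submxK; congr block_mx.
  by apply/matrixP => i j; rewrite !ord1 !mxE mulr1n /a; congr (Q _ _); apply: val_inj.
by rewrite /r trmx_ursub; case: pdQ => -> _.
Qed.

Let qfQ (x : R) (t : 'cV[R]_d) :
  qf Q (col_mx x%:M t) = a * x ^+ 2 + 2 * x * (r *m t) 0 0 + (t^T *m drsubmx Q *m t) 0 0.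
Proof.
rewrite /qf [in LHS]QE tr_col_mx mul_row_block mul_row_col !mulmxDl tr_scalar_mx.
have -> : t^T *m r^T = r *m t by rewrite -trmx_mul row_col_scalar tr_scalar_mx.
rewrite !mul_scalar_mx -!scalemxAl (row_col_scalar r t) -!scalar_mxM.
move: ((r *m t) 0 0) (t^T *m drsubmx Q *m t) => y w.
rewrite !mxE !mulr1n; ring.
Qed.

Lemma schur_corner_gt0 : 0 < a.
Proof.
have /(pdQ.2 _) : col_mx 1%:M 0 != 0 :> 'cV[R]_(1 + d).
  by rewrite col_mx_eq0 negb_and matrix_nonzero1.
by rewrite qfQ !mulmx0 mxE mulr0 expr1n mulr1 !addr0.
Qed.

Let a0 := schur_corner_gt0.
Let an0 : a != 0 := lt0r_neq0 a0.

(** Completes the square in the first variable, which then enters only through a shift by a linear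
    form in the other variables. *)
Lemma qf_schur (x : R) (t : 'cV[R]_d) :
  qf Q (col_mx x%:M t) = a * (x + a^-1 * (r *m t) 0 0) ^+ 2 + qf schurmx t.
Proof.
rewrite qfQ /qf /schurmx mulmxBr mulmxBl.
rewrite -scalemxAr -scalemxAl mulmxA -(mulmxA _ r t).
have -> : t^T *m r^T = r *m t by rewrite -trmx_mul row_col_scalar tr_scalar_mx.
rewrite (row_col_scalar r t) -scalar_mxM.
move: ((r *m t) 0 0) (t^T *m drsubmx Q *m t) => y w.
by rewrite !mxE !mulr1n; field.
Qed.

Lemma posdef_schur : posdefmx schurmx.
Proof.
split.
  by rewrite /schurmx linearB/= linearZ/= trmx_mul trmxK trmx_drsub pdQ.1.
move=> t t0; have := @qf_schur (- (a^-1 * (r *m t) 0 0)) t.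
rewrite addNr expr0n mulr0 add0r => <-; apply: pdQ.2.
by rewrite col_mx_eq0 negb_and t0 orbT.
Qed.

Lemma det_schur : \det Q = a * \det schurmx.
Proof.
have -> : Q = block_mx 1%:M 0 (a^-1 *: r^T) 1%:M *m block_mx a%:M r 0 schurmx.
  rewrite mulmx_block !mul1mx !mul0mx !addr0 [LHS]QE.
  rewrite mul_mx_scalar scalerA mulfV// scale1r /schurmx -scalemxAl.
  by rewrite addrC subrK.
by rewrite det_mulmx det_lblock det_ublock !det1 !mul1r det_scalar1.
Qed.

End Schur.

Lemma split_cV_bij d : set_bij [set: 'cV[int]_d * int] [set: 'cV[int]_(1 + d)]
  (fun p => col_mx (const_mx p.2) p.1).
Proof.
split=> //.
  move=> [p x] [q y] _ _ /= /eq_col_mx[/matrixP/(_ 0 0)]; rewrite !mxE => -> -> //.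
move=> v _; exists (dsubmx v, usubmx v 0 0) => //=.
rewrite -[RHS]vsubmxK; congr col_mx; apply/matrixP => i j.
by rewrite !ord1 !mxE.
Qed.

(** Induction on d. By [qf_schur], once the other coordinates are fixed, the sum over the first one
    is a one-dimensional Gaussian sum whose offset depends on them; the bound being uniform in the
    offset, it factors out. What remains is a sum for the Schur complement. Positivity of the
    determinant comes along through [det_schur]. *)
Lemma gauss_esum_near d (Q : 'M[R]_d) : posdefmx Q ->
  0 < \det Q /\ forall e, 0 < e -> \forall h \near 0^'+, forall u : 'cV[R]_d,
  ((gauss_mass Q - e)%:E <=
   \esum_(k in [set: 'cV[int]_d])
      (h ^+ d * expR (- (qf Q (h *: mxR k + u) / 2)))%:E <=
   (gauss_mass Q + e)%:E)%E.
Proof.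
elim: d Q => [|d IH] Q pdQ.
  rewrite det_mx00; split=> // e e0; near=> h => u.
  have -> : [set: 'cV[int]_0] = [set 0].
    by apply/seteqP; split=> // k _; rewrite [k]flatmx0.
  rewrite esum_set1; last by rewrite lee_fin expr0 mul1r expR_ge0.
  rewrite /gauss_mass det_mx00 expr0 divr1 sqrtr1 expr0 mul1r.
  rewrite [_ + u]flatmx0 /qf mulmx0 mxE mul0r oppr0 expR0 !lee_fin.
  by rewrite lerBlDr lerDl ltW.
have {IH}[detS IH] := IH _ (posdef_schur pdQ).
have a0 := schur_corner_gt0 pdQ.
set a := Q 0 0 in a0 *.
set S := schurmx Q in detS IH.
have detQ : \det Q = a * \det S by exact: det_schur.
split; first by rewrite detQ mulr_gt0.
move=> e e0.
set s1 := Num.sqrt (2 * pi / a).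
have s0 : 0 < s1 by rewrite sqrtr_gt0 divr_gt0// mulr_gt0// pi_gt0.
set G := gauss_mass S in IH.
have G0 : 0 <= G by exact: sqrtr_ge0.
have GE : gauss_mass Q = s1 * G.
  rewrite /s1 /G /gauss_mass -sqrtrM ?divr_ge0 ?mulr_ge0 ?pi_ge0 ?(ltW a0)//.
  congr Num.sqrt; rewrite detQ exprS.
  by field; rewrite !gt_eqF.
(* Chosen so that [s1 * e2] and [e1 * (G + e2)] are at most [e / 2] each; [e1 <= s1] keeps the
   factor [s1 - e1] nonnegative. *)
pose e2 := e / (2 * s1).
have e20 : 0 < e2 by rewrite divr_gt0// mulr_gt0.
pose e1 := Num.min s1 (e / (2 * (G + e2))).
have e10 : 0 < e1.
  by rewrite lt_min s0 divr_gt0// mulr_gt0// ltr_wpDl.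
near=> h => u.
have h0 : 0 < h by [].
pose ud : 'cV[R]_d := dsubmx (u : 'cV[R]_(1 + d)).
pose u0 : R := usubmx (u : 'cV[R]_(1 + d)) 0 0.
pose r : 'rV[R]_d := ursubmx (Q : 'M[R]_(1 + d)).
have hQ : forall p : 'cV[int]_d * int,
    (h ^+ d.+1 * expR (- (qf Q (h *: mxR (col_mx (const_mx p.2 : 'M[int]_1) p.1) + u) / 2)))%:E =
    ((h ^+ d * expR (- (qf S (h *: mxR p.1 + ud) / 2)))%:E *
    (h * expR (- (a / 2 * (h * (p.2)%:~R + (u0 +
       a^-1 * (r *m (h *: mxR p.1 + ud)) 0 0)) ^+ 2)))%:E)%E.
  move=> p; rewrite -EFinM mulrACA -exprSr; congr (_ * _)%:E.
  rewrite -expRD; congr expR.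
  have -> : h *: mxR (col_mx (const_mx p.2 : 'M[int]_1) p.1) + u =
     col_mx (h * (p.2)%:~R + u0)%:M (h *: mxR p.1 + ud).
    rewrite -[u in LHS](@vsubmxK _ 1 d) /mxR map_col_mx scale_col_mx add_col_mx.
    by congr col_mx; apply/matrixP => i j; rewrite /u0 !ord1 !mxE mulr1n.
  rewrite (@qf_schur d Q pdQ) -/a -/S -/r.
  move: ((r *m _) 0 0) (qf S _) => y w; lra.
rewrite (@reindex_esum R _ _ setT setT _ _ (split_cV_bij d)).
under eq_esum do rewrite hQ.
have <- : setT `*`` (fun=> setT) = [set: 'cV[int]_d * int].
  by apply/seteqP; split.
rewrite -(@esum_esum _ _ _ setT (fun=> setT) (fun p k =>
  ((h ^+ d * expR (- (qf S (h *: mxR p + ud) / 2)))%:E *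
   (h * expR (- (a / 2 * (h * k%:~R +
     (u0 + a^-1 * (r *m (h *: mxR p + ud)) 0 0)) ^+ 2)))%:E)%E)); last first.
  by move=> i j _ _; rewrite -EFinM lee_fin !mulr_ge0 ?exprn_ge0 ?expR_ge0 ?(ltW h0).
under eq_esum => p _.
  rewrite esumZl; first over.
  - by rewrite mulr_ge0 ?exprn_ge0 ?expR_ge0 ?(ltW h0).
  - by move=> i; rewrite lee_fin mulr_ge0 ?expR_ge0 ?(ltW h0).
have B1 : forall c,
  ((s1 - e1)%:E <=
   \esum_(k in [set: int]) (h * expR (- (a / 2 * (h * k%:~R + c) ^+ 2)))%:E <=
   (s1 + e1)%:E)%E by near: h; exact: gauss_esum1_near.
have B2 : forall u : 'cV[R]_d,
  ((G - e2)%:E <=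
   \esum_(k in [set: 'cV[int]_d])
      (h ^+ d * expR (- (qf S (h *: mxR k + u) / 2)))%:E <=
   (G + e2)%:E)%E by near: h; exact: IH.
have e1s : e1 <= s1 by rewrite ge_min lexx.
have e1e : e1 * (G + e2) <= e / 2.
  have -> : e / 2 = e / (2 * (G + e2)) * (G + e2).
    by field; rewrite gt_eqF// ltr_wpDl.
  by rewrite ler_wpM2r ?addr_ge0 ?(ltW e20)// ge_min lexx orbT.
have e2e : s1 * e2 = e / 2 by rewrite /e2; field; rewrite gt_eqF.
have /andP[l2 u2] := B2 ud.
rewrite GE; apply/andP; split.
  apply: (@le_trans _ _ ((s1 - e1)%:E * (G - e2)%:E)%E).
    rewrite -EFinM lee_fin.
    have : 0 <= e1 * e2 by rewrite mulr_ge0// ltW.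
    nra.
  apply: (@le_trans _ _ ((s1 - e1)%:E * \esum_(k in [set: 'cV[int]_d])
      (h ^+ d * expR (- (qf S (h *: mxR k + ud) / 2)))%:E)%E).
    by rewrite lee_wpmul2l// lee_fin subr_ge0.
  rewrite -esumZl ?subr_ge0//; last first.
      by move=> i; rewrite lee_fin mulr_ge0 ?exprn_ge0 ?expR_ge0 ?(ltW h0).
  apply: le_esum => k _; rewrite muleC lee_wpmul2l//.
    by rewrite lee_fin mulr_ge0 ?exprn_ge0 ?expR_ge0 ?(ltW h0).
  by have /andP[] := B1 (u0 +
       a^-1 * (r *m (h *: mxR k + ud)) 0 0).
apply: (@le_trans _ _ ((s1 + e1)%:E * (G + e2)%:E)%E); last first.
  rewrite -EFinM lee_fin; nra.
apply: (@le_trans _ _ ((s1 + e1)%:E * \esum_(k in [set: 'cV[int]_d])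
    (h ^+ d * expR (- (qf S (h *: mxR k + ud) / 2)))%:E)%E); last first.
  by rewrite lee_wpmul2l// lee_fin addr_ge0// ltW.
rewrite -esumZl ?addr_ge0 ?(ltW s0) ?(ltW e10)//; last first.
      by move=> i; rewrite lee_fin mulr_ge0 ?exprn_ge0 ?expR_ge0 ?(ltW h0).
apply: le_esum => k _; rewrite [leRHS]muleC lee_wpmul2l//.
  by rewrite lee_fin mulr_ge0 ?exprn_ge0 ?expR_ge0 ?(ltW h0).
by have /andP[] := B1 (u0 +
     a^-1 * (r *m (h *: mxR k + ud)) 0 0).
Unshelve. all: by end_near. Qed.

End QuadraticGaussianSums.

(** * Trigonometric bounds and the factor of a single geometric variable *)

Section TrigonometricEstimates.
Context {R : realType}.
Implicit Types x y u : R.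

(** Mean value theorem between 0 and u for either sign of u; [0 <= c * u] records that c lies on the
    same side of 0 as u. *)
Lemma MVT0 (f df : R -> R) u : (forall x, is_derive x 1 f (df x)) ->
  exists2 c, `|c| <= `|u| /\ 0 <= c * u & f u = f 0 + df c * u.
Proof.
move=> fd.
have cf x : {for x, continuous f}.
  by apply: differentiable_continuous; apply/derivable1_diffP; case: (fd x).
have [u0|u0] := leP 0 u.
  have [|c /[!in_itv]/= /andP[c0 cu] e] := @MVT_segment R f df 0 u u0 (fun x _ => fd x).
    exact: continuous_subspaceT.
  exists c; last by rewrite -[X in _ * X]subr0 -e; ring.
  by rewrite !ger0_norm// mulr_ge0.
have [|c /[!in_itv]/= /andP[c0 cu] e] := @MVT_segment R f df u 0 (ltW u0) (fun x _ => fd x).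
  exact: continuous_subspaceT.
exists c; last by apply/eqP; rewrite -subr_eq0 -[X in _ * X](opprK u) -[- u]sub0r mulrN -e; apply/eqP; ring.
by rewrite !ler0_norm ?lerN2 ?(ltW u0)// mulr_le0// ltW.
Qed.

Lemma cos_norm_sub1_le u : `|cos u - 1| <= `|u|.
Proof.
have [c _ ->] := MVT0 u (fun x => @is_derive_cos R x).
by rewrite cos0 addrAC subrr add0r normrM normrN ler_piMl// sin_max.
Qed.

Lemma sin_norm_le u : `|sin u| <= `|u|.
Proof.
have [c _ ->] := MVT0 u (fun x => @is_derive_sin R x).
by rewrite sin0 add0r normrM ler_piMl// cos_max.
Qed.

Lemma sin_sub_id_le u : `|sin u - u| <= u ^+ 2.
Proof.
have D x : is_derive x 1 (fun u : R => sin u - u) (cos x - 1).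
  by apply: is_derive_eq.
have [c [cu _] ->] := MVT0 u D.
rewrite sin0 subrr add0r normrM -real_normK ?num_real// expr2 ler_wpM2r//.
exact: le_trans (cos_norm_sub1_le c) cu.
Qed.

Lemma cos_le u : 1 - cos u <= u ^+ 2 / 2.
Proof.
have -> : 1 - cos u = 2 * sin (u / 2) ^+ 2.
  have -> : cos u = cos ((u / 2) *+ 2) by congr cos; rewrite -mulr_natr; field.
  by rewrite cos_mulr2n cos2sin2; ring.
have := sin_norm_le (u / 2); rewrite -ler_sqr ?nnegrE// !real_normK ?num_real//.
by move=> h; nra.
Qed.

Lemma sin_ge u : 0 <= u -> u - u ^+ 3 / 6 <= sin u.
Proof.
move=> u0.
have D x : is_derive x 1 (fun u : R => sin u - (u - u ^+ 3 / 6)) (cos x - 1 + x ^+ 2 / 2).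
  by apply: is_derive_eq; rewrite /GRing.scale/=; field.
have [c _ e] := MVT0 u D.
rewrite -subr_ge0 e sin0 expr0n !mul0r subrr subrr add0r mulr_ge0//.
by have := cos_le c; lra.
Qed.

Lemma cos_upper u : cos u <= 1 - u ^+ 2 / 2 + u ^+ 4 / 24.
Proof.
wlog u0 : u / 0 <= u.
  move=> H; have [|u0] := leP 0 u; first exact: H.
  by have := H (- u); rewrite oppr_ge0 (ltW u0) cosN !exprS !expr0 => /(_ isT); lra.
have D x : is_derive x 1 (fun u : R => 1 - u ^+ 2 / 2 + u ^+ 4 / 24 - cos u) (sin x - (x - x ^+ 3 / 6)).
  by apply: is_derive_eq; rewrite /GRing.scale/=; field.
have [c [cu cu0] e] := MVT0 u D.
rewrite -subr_ge0 e cos0 !expr0n !mul0r subr0 addr0 subrr add0r.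
have [->|un0] := eqVneq u 0; first by rewrite mulr0.
rewrite mulr_ge0// subr_ge0 sin_ge//.
by move: cu0; rewrite pmulr_lge0// lt_neqAle eq_sym un0.
Qed.

(** For [x = u / 2] the cosine lies in [0, 1], so [1 - cos u = 2 * (1 - cos x ^+ 2) >= 2 * (1 - cos
    x)]. The quartic bound on [cos x] and [x ^+ 2 <= 4] leave at least [2 / 3 * x ^+ 2]. *)
Lemma one_sub_cos_ge u : `|u| <= pi -> u ^+ 2 / 6 <= 1 - cos u.
Proof.
move=> up; set x := u / 2.
have x2 : x ^+ 2 <= 4.
  have -> : 4 = 2 ^+ 2 :> R by ring.
  rewrite -(real_normK (num_real x)) ler_sqr ?nnegrE// /x normrM [X in _ * X]ger0_norm//.
  by have := @pihalf_lt2 R; lra.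
have c0 : 0 <= cos x.
  apply: cos_ge0_pihalf; rewrite -ler_norml /x normrM [X in _ * X]ger0_norm//; lra.
have uE : u = 2 * x by rewrite /x; field.
have -> : cos u = 2 * cos x ^+ 2 - 1.
  have -> : u = x *+ 2 by rewrite -mulr_natl.
  by rewrite cos_mulr2n mulr_natl.
have c1 := @cos_le1 R x.
have := cos_upper x.
rewrite (_ : x ^+ 4 = x ^+ 2 * x ^+ 2); last by rewrite -exprD.
have -> : u ^+ 2 / 6 = 2 / 3 * x ^+ 2 by rewrite /x; field.
have := sqr_ge0 x.
move: x2 c0 c1; set y := x ^+ 2; set c := cos x => x2 c0 c1 y0 h.
have : 0 <= c * (1 - c) by rewrite mulr_ge0// subr_ge0.
have : 0 <= y * (4 - y) by rewrite mulr_ge0// subr_ge0.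
by rewrite expr2; lra.
Qed.

Lemma expR_sub_sqr_le x : 0 <= x -> expR (x - x ^+ 2) <= 1 + x.
Proof.
move=> x0; have h : 0 < 1 + x by rewrite ltr_pwDl.
have := @expR_ge1Dx R (- x / (1 + x)).
have -> : 1 + - x / (1 + x) = (1 + x)^-1 by field; rewrite gt_eqF.
rewrite mulNr expRN lef_pV2 ?posrE ?expR_gt0// => /(le_trans _); apply.
rewrite ler_expR ler_pdivlMr//.
have := exprn_ge0 3 x0; rewrite !exprS expr0; nra.
Qed.

Import Normc.

Definition cis x : R[i] := Complex (cos x) (sin x).

Lemma cisD x y : cis (x + y) = cis x * cis y.
Proof.
apply/eqP; rewrite eq_complex /= cosD sinD eqxx/=; apply/eqP; ring.
Qed.

Lemma cis0 : cis 0 = 1.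
Proof. by rewrite /cis cos0 sin0. Qed.

Lemma normc_cis x : normc (cis x) = 1.
Proof. by rewrite /normc /= cos2Dsin2 sqrtr1. Qed.

Lemma cis_neq0 x : cis x != 0.
Proof.
apply/eqP => e; have := normc_cis x; rewrite e normc0 => /esym/eqP.
by rewrite oner_eq0.
Qed.

Lemma cisN x : cis (- x) = (cis x)^-1.
Proof.
apply: (mulIf (cis_neq0 x)); rewrite -cisD addNr cis0 mulVf//; exact: cis_neq0.
Qed.

Lemma cisMn x (n : nat) : cis (x *+ n) = cis x ^+ n.
Proof.
by elim: n => [|n IH]; rewrite ?mulr0n ?cis0// mulrS cisD IH exprS.
Qed.

Lemma cis2pi : cis (2 * pi) = 1.
Proof. by rewrite /cis mulr_natl cos2pi sin2pi. Qed.

Lemma cis2pi_int (k : int) : cis (2 * pi * k%:~R) = 1.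
Proof.
have cn (n : nat) : cis (2 * pi * n%:R) = 1.
  by rewrite mulr_natr cisMn cis2pi expr1n.
case: k => n; first exact: cn.
by rewrite NegzE rmorphN/= mulrN cisN cn invr1.
Qed.

Lemma cis_sum (I : Type) (r : seq I) (P : pred I) (f : I -> R) :
  cis (\sum_(i <- r | P i) f i) = \prod_(i <- r | P i) cis (f i).
Proof. exact: (big_morph _ cisD cis0). Qed.

Definition geom_den (z u : R) : R[i] := 1 + z%:C%C - z%:C%C * cis u.

(** Characteristic function at u of X - z, for X geometric with mean z; [geom_den] is the reciprocal
    of that of X. *)
Definition geom_fac (z u : R) : R[i] := cis (- (z * u)) / geom_den z u.

Lemma geom_denE z u : geom_den z u = Complex (1 + z - z * cos u) (- (z * sin u)).
Proof.
apply/eqP; rewrite eq_complex /=; apply/andP; split; apply/eqP; ring.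
Qed.

Lemma normc_geom_den z u : normc (geom_den z u) =
  Num.sqrt (1 + 2 * (z + z ^+ 2) * (1 - cos u)).
Proof.
rewrite geom_denE /normc; congr Num.sqrt.
have -> : (- (z * sin u)) ^+ 2 = z ^+ 2 * (1 - cos u ^+ 2).
  by rewrite sqrrN exprMn sin2cos2.
ring.
Qed.

Lemma normc_geom_fac z u : normc (geom_fac z u) =
  (Num.sqrt (1 + 2 * (z + z ^+ 2) * (1 - cos u)))^-1.
Proof. by rewrite /geom_fac normcM normc_cis mul1r normcV normc_geom_den. Qed.

Lemma geom_den_neq0 z u : 0 <= z -> geom_den z u != 0.
Proof.
move=> z0; apply/eqP => e; have := normc_geom_den z u; rewrite e normc0 => /esym/eqP.
rewrite sqrtr_eq0 leNgt => /negP; apply.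
by rewrite ltr_pwDl// !mulr_ge0// ?addr_ge0 ?exprn_ge0// subr_ge0 cos_le1.
Qed.

(** With [v = z + z ^+ 2], the inverse square of the modulus is 1 + x for [x = 2 * v * (1 - cos u)],
    and [1 + x >= expR (x - x ^+ 2)]. The hypothesis bounds both [u ^+ 2] and [v * u ^+ 2] by
    [w ^+ 2]. The quartic term of the cosine then costs a proportion [w ^+ 2 / 12], and [x ^+ 2] a
    proportion [w ^+ 2]: together 13 / 12. *)
Lemma normc_geom_fac_le z u w : 0 <= z -> u ^+ 2 <= w ^+ 2 * (z / (1 + z) ^+ 3) ->
  normc (geom_fac z u) <=
  expR (- ((z + z ^+ 2) * u ^+ 2 / 2) * (1 - 13 / 12 * w ^+ 2)).
Proof.
move=> z0 uw; set v := z + z ^+ 2.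
have v0 : 0 <= v by rewrite addr_ge0 ?exprn_ge0.
have z1 : 0 < 1 + z by rewrite ltr_pwDl.
have f1 : z / (1 + z) ^+ 3 <= 1.
  rewrite ler_pdivrMr ?exprn_gt0// mul1r !exprS expr0; have := exprn_ge0 3 z0.
  rewrite !exprS expr0; nra.
have u2w : u ^+ 2 <= w ^+ 2.
  by apply: (le_trans uw); rewrite ler_piMr ?sqr_ge0.
have vu2w : v * u ^+ 2 <= w ^+ 2.
  apply: (le_trans (ler_wpM2l v0 uw)).
  rewrite mulrCA ler_piMr ?sqr_ge0//.
  rewrite mulrA ler_pdivrMr ?exprn_gt0// mul1r /v; have := exprn_ge0 3 z0.
  rewrite !exprS expr0; nra.
rewrite normc_geom_fac -/v mulNr expRN lef_pV2 ?posrE ?expR_gt0//; last first.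
  rewrite sqrtr_gt0 ltr_pwDl// !mulr_ge0// subr_ge0 cos_le1//.
rewrite -(ger0_norm (expR_ge0 _)) -sqrtr_sqr ler_wsqrtr//.
rewrite expr2 -expRD.
set x := 2 * v * (1 - cos u).
have x0 : 0 <= x by rewrite !mulr_ge0// subr_ge0 cos_le1.
apply: le_trans (expR_sub_sqr_le x0); rewrite ler_expR.
have xu : x <= v * u ^+ 2.
  by rewrite /x; have := cos_le u; nra.
have xl : v * u ^+ 2 - v * u ^+ 4 / 12 <= x.
  have := ler_wpM2l v0 (cos_upper u).
  by rewrite /x; move: (u ^+ 4) (u ^+ 2) (cos u) => a b c; lra.
have u4 : v * u ^+ 4 <= v * u ^+ 2 * w ^+ 2.
  rewrite (_ : u ^+ 4 = u ^+ 2 * u ^+ 2); last by rewrite -exprD.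
  by rewrite mulrA ler_wpM2l// mulr_ge0 ?sqr_ge0.
have x2 : x ^+ 2 <= v * u ^+ 2 * w ^+ 2.
  rewrite expr2; apply: ler_pM => //; exact: le_trans xu vu2w.
move: x2 u4 xl; move: (x ^+ 2) (v * u ^+ 4) (w ^+ 2) => a b c; lra.
Qed.

(* With v = z + z ^+ 2, the left-hand side is X + i Y - 1 for
   X + i Y = (1 + z - z e^(i x)) e^(i z x) e^(- v x^2 / 2) at x = u, whose
   derivative is of order v (1 + z) x^2 because the lower orders cancel. *)
Lemma gauss_div_geom_fac z u : 0 <= z ->
  normc ((expR (- ((z + z ^+ 2) * u ^+ 2 / 2)))%:C%C / geom_fac z u - 1) <=
  4 * (z + z ^+ 2) * (1 + z) * `|u| ^+ 3.
Proof.
move=> z0; set v := z + z ^+ 2.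
have v0 : 0 <= v by rewrite addr_ge0 ?exprn_ge0.
pose g (x : R) := expR (- (v / 2 * x ^+ 2)).
pose X x := g x * ((1 + z - z * cos x) * cos (z * x) + z * sin x * sin (z * x)).
pose Y x := g x * ((1 + z - z * cos x) * sin (z * x) - z * sin x * cos (z * x)).
(* The derivative of X + i Y is v g(x) e^(i z x) (p(x) + i q(x)), with p and q bounded by (1 + z)
   x^2. *)
pose p x := (sin x - x) - x * z * (1 - cos x).
pose q x := x * z * sin x + (1 - cos x).
pose dX x := v * g x * (cos (z * x) * p x - sin (z * x) * q x).
pose dY x := v * g x * (sin (z * x) * p x + cos (z * x) * q x).
have hX x : is_derive x 1 X (dX x).
  apply: is_derive_eq; rewrite /GRing.scale/= /dX /p /q /v /g.
  by move: (cos (z * x)) (sin (z * x)) (expR _) (cos x) (sin x) => c s e C S; field.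
have hY x : is_derive x 1 Y (dY x).
  apply: is_derive_eq; rewrite /GRing.scale/= /dY /p /q /v /g.
  by move: (cos (z * x)) (sin (z * x)) (expR _) (cos x) (sin x) => c s e C S; field.
have g1 x : 0 <= g x <= 1.
  rewrite expR_ge0 -expR0 ler_expR oppr_le0 mulr_ge0 ?sqr_ge0// divr_ge0//.
have x2 x : x ^+ 2 = `|x| * `|x| by rewrite -normrM -expr2 ger0_norm ?sqr_ge0.
have cos1 x : `|1 - cos x| <= x ^+ 2.
  rewrite ger0_norm ?subr_ge0 ?cos_le1//; have := cos_le x; have := sqr_ge0 x; lra.
have cos1' x : `|1 - cos x| <= `|x| by rewrite distrC cos_norm_sub1_le.
have hp x : `|p x| <= (1 + z) * x ^+ 2.
  apply: (le_trans (ler_normB _ _)); rewrite mulrDl mul1r lerD ?sin_sub_id_le//.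
  rewrite !normrM (ger0_norm z0) x2 mulrAC mulrC ler_wpM2l// ler_wpM2l//.
have hq x : `|q x| <= (1 + z) * x ^+ 2.
  apply: (le_trans (ler_normD _ _)); rewrite addrC mulrDl mul1r lerD ?cos1//.
  rewrite !normrM (ger0_norm z0) x2 mulrAC mulrC ler_wpM2l// ler_wpM2l// sin_norm_le//.
have mix (a b : R) x : `|a| <= 1 -> `|b| <= 1 ->
    `|v * g x * (a * p x + b * q x)| <= 2 * v * (1 + z) * x ^+ 2.
  move=> a1 b1; have /andP[g0 gle] := g1 x.
  rewrite normrM ger0_norm ?mulr_ge0//.
  have H : `|a * p x + b * q x| <= 2 * ((1 + z) * x ^+ 2).
    rewrite mulr_natl mulr2n; apply: (le_trans (ler_normD _ _)).
    by rewrite !normrM lerD// -[leRHS]mul1r ler_pM.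
  apply: (@le_trans _ _ (v * 1 * (2 * ((1 + z) * x ^+ 2)))); last by lra.
  by apply: ler_pM => //; [exact: mulr_ge0|exact: ler_wpM2l].
have fin (f df : R -> R) : (forall x, is_derive x 1 f (df x)) ->
    (forall x, `|df x| <= 2 * v * (1 + z) * x ^+ 2) ->
    `|f u - f 0| <= 2 * v * (1 + z) * `|u| ^+ 3.
  move=> hf hdf; have [c [cu _] ->] := MVT0 u hf.
  rewrite addrAC subrr add0r normrM exprSr mulrA ler_wpM2r//.
  have vz : 0 <= 2 * v * (1 + z) by rewrite mulr_ge0 ?addr_ge0// mulr_ge0.
  apply: (le_trans (hdf c)); rewrite ler_wpM2l//.
  by rewrite -(real_normK (num_real c)) ler_sqr ?nnegrE.
have BX : `|X u - 1| <= 2 * v * (1 + z) * `|u| ^+ 3.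
  have X0 : X 0 = 1 by rewrite /X /g expr0n/= mulr0 oppr0 expR0 cos0 sin0 mulr0 cos0 sin0; ring.
  have := fin X dX hX; rewrite X0; apply => x; rewrite /dX -mulNr.
  by apply: mix; rewrite ?normrN ?cos_max ?sin_max.
have BY : `|Y u| <= 2 * v * (1 + z) * `|u| ^+ 3.
  have Y0 : Y 0 = 0 by rewrite /Y /g expr0n/= mulr0 oppr0 expR0 cos0 sin0 mulr0 cos0 sin0; ring.
  have := fin Y dY hY; rewrite Y0 subr0; apply => x.
  by apply: mix; rewrite ?cos_max ?sin_max.
have -> : (expR (- (v * u ^+ 2 / 2)))%:C%C / geom_fac z u - 1 = Complex (X u - 1) (Y u).
  rewrite /geom_fac invf_div cisN invrK geom_denE.
  have -> : expR (- (v * u ^+ 2 / 2)) = g u by rewrite /g; congr expR; field.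
  rewrite /X /Y /cis.
  apply/eqP; rewrite eq_complex /=; apply/andP; split; apply/eqP; ring.
apply: (@le_trans _ _ (`|X u - 1| + `|Y u|)); last by lra.
rewrite /normc -[leRHS]ger0_norm ?addr_ge0// -sqrtr_sqr ler_wsqrtr//.
rewrite -(real_normK (num_real (X u - 1))) -(real_normK (num_real (Y u))).
have := mulr_ge0 (normr_ge0 (X u - 1)) (normr_ge0 (Y u)); nra.
Qed.

End TrigonometricEstimates.

(** * The characteristic function near the origin and away from it *)

Section CharacteristicFunction.
Context {R : realType}.
Import Normc.

Lemma normc_ge0 (x : R[i]) : 0 <= normc x.
Proof. by case: x => a b; exact: sqrtr_ge0. Qed.

Lemma normcD (x y : R[i]) : normc (x + y) <= normc x + normc y.
Proof. exact: le_normcD. Qed.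

Lemma normc_prod (I : Type) (r : seq I) (P : pred I) (f : I -> R[i]) :
  normc (\prod_(i <- r | P i) f i) = \prod_(i <- r | P i) normc (f i).
Proof. exact: (big_morph _ (@normcM R) (@normc1 R)). Qed.

Lemma normcB_prod1 (I : Type) (r : seq I) (f : I -> R[i]) :
  normc (\prod_(i <- r) f i - 1) <= expR (\sum_(i <- r) normc (f i - 1)) - 1.
Proof.
elim: r => [|i r IH]; first by rewrite !big_nil subrr normc0 expR0 subrr.
rewrite !big_cons expRD.
set p := \prod_(j <- r) f j in IH *; set s := expR _ in IH.
set a := normc (f i - 1).
have -> : f i * p - 1 = (f i - 1) * p + (p - 1) by ring.
apply: (le_trans (normcD _ _)); rewrite normcM -/a.
have s1 : 1 <= s by rewrite -subr_ge0; exact: le_trans (normc_ge0 _) IH.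
have hp : normc p <= s.
  have -> : p = (p - 1) + 1 by ring.
  by apply: (le_trans (normcD _ _)); rewrite normc1 -lerBrDr.
have ea : 1 + a <= expR a by exact: expR_ge1Dx.
have a0 : 0 <= a := normc_ge0 _.
have h1 := ler_wpM2l a0 hp.
have h2 : (1 + a) * s <= expR a * s by rewrite ler_wpM2r// (le_trans _ s1).
apply: (le_trans (lerD h1 IH)).
by rewrite addrA lerD2r (le_trans _ h2)// mulrDl mul1r addrC.
Qed.

(** Convexity of the exponential gives 1 + c x >= (1 + c)^x for x in [0, 1]; the product then
    depends only on the sum of the exponents. *)
Lemma prod_Bernoulli (I : finType) (c : R) (x : I -> R) (m : nat) :
  0 <= c -> (forall i, 0 <= x i <= 1) -> m%:R <= \sum_i x i ->
  (1 + c) ^+ m <= \prod_i (1 + c * x i).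
Proof.
move=> c0 x01 mx; have c1 : 0 < 1 + c by rewrite ltr_pwDl.
pose L := ln (1 + c).
have L0 : 0 <= L by rewrite ln_ge0// lerDl.
have cE : expR L = 1 + c by rewrite lnK.
apply: (@le_trans _ _ (expR (L * \sum_i x i))).
  rewrite -cE -expRM_natl ler_expR mulrC ler_wpM2l//.
rewrite mulr_sumr expR_sum; apply: ler_prod => i _; rewrite expR_ge0/=.
have /andP[xi0 xi1] := x01 i.
have := @convex_expR R (Itv01 xi0 xi1) L 0.
rewrite !convRE/= mulr0 addr0 expR0 cE.
rewrite [x i * L]mulrC => h; apply: (le_trans h); rewrite /unstable.onem; lra.
Qed.

Section CharFun.
Variables (n : nat) (z s : 'I_n -> R).
Hypothesis z0 : forall j, 0 <= z j.

(** For [s j] the scalar product of a_j and t, this is the characteristic function of A (X - z) at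
    t. *)
Definition charfun : R[i] := \prod_j geom_fac (z j) (s j).

Let q := \sum_j (z j + z j ^+ 2) * s j ^+ 2 / 2.

Lemma charfun_neq0 : charfun != 0.
Proof.
apply/prodf_neq0 => j _; rewrite mulf_neq0 ?cis_neq0// invr_eq0.
exact: geom_den_neq0.
Qed.

Section Small.
Variable w : R.
Hypothesis w0 : 0 <= w.
Hypothesis sw : forall j, s j ^+ 2 <= w ^+ 2 * (z j / (1 + z j) ^+ 3).

Lemma normc_charfun_le : normc charfun <= expR (- q * (1 - 13 / 12 * w ^+ 2)).
Proof.
rewrite normc_prod /q -sumrN mulr_suml expR_sum.
by apply: ler_prod => j _; rewrite normc_ge0 normc_geom_fac_le.
Qed.

(** The hypothesis on s yields [(1 + z j) * |s j| <= w], which turns each cubic error of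
    [gauss_div_geom_fac] into [8 * w] times the corresponding term of q. *)
Lemma gauss_div_charfun :
  normc ((expR (- q))%:C%C / charfun - 1) <= expR (8 * q * w) - 1.
Proof.
have -> : (expR (- q))%:C%C / charfun =
  \prod_j ((expR (- ((z j + z j ^+ 2) * s j ^+ 2 / 2)))%:C%C / geom_fac (z j) (s j)).
  by rewrite prodf_div /q -sumrN expR_sum rmorph_prod.
apply: (le_trans (normcB_prod1 _ _)); rewrite lerD2r ler_expR.
rewrite /q mulr_sumr mulr_suml; apply: ler_sum => j _.
apply: (le_trans (gauss_div_geom_fac _ (z0 j))).
set v := z j + z j ^+ 2.
have v0 : 0 <= v by rewrite addr_ge0 ?exprn_ge0.
have sE : s j ^+ 2 = `|s j| ^+ 2 by rewrite real_normK ?num_real.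
have z1 : 0 < 1 + z j by rewrite ltr_pwDl.
have H : (1 + z j) * `|s j| <= w.
  rewrite -ler_sqr ?nnegrE ?mulr_ge0 ?(ltW z1)// exprMn -sE.
  apply: (le_trans (ler_wpM2l (sqr_ge0 _) (sw j))).
  rewrite mulrCA ler_piMr ?sqr_ge0// mulrA ler_pdivrMr ?exprn_gt0// mul1r.
  rewrite exprSr mulrC ler_wpM2r ?sqr_ge0//.
  by rewrite lerDr.
have := ler_wpM2l (mulr_ge0 v0 (sqr_ge0 (s j))) H.
rewrite sE => h; rewrite exprS; move: h; move: `|s j| => y; lra.
Qed.

(** The relative error is taken as exp (- q) / F - 1, since the inverse of [geom_fac] has no
    denominator and is easy to differentiate; multiplying by F restores the difference. *)
Lemma charfun_sub_gauss :
  normc (charfun - (expR (- q))%:C%C) <=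
  expR (- q + 13 / 12 * w ^+ 2 * q) * (expR (8 * q * w) - 1).
Proof.
have -> : charfun - (expR (- q))%:C%C = - (charfun * ((expR (- q))%:C%C / charfun - 1)).
  by rewrite mulrBr mulr1 mulrCA mulfV ?charfun_neq0// mulr1 opprB.
rewrite normcN normcM; apply: ler_pM; rewrite ?normc_ge0// ?gauss_div_charfun//.
apply: (le_trans normc_charfun_le); rewrite ler_expR; lra.
Qed.

End Small.

End CharFun.

Lemma mod_2pi (u : R) : exists k : int, `|u - 2 * pi * k%:~R| <= pi.
Proof.
have p0 : 0 < 2 * pi :> R by rewrite mulr_gt0// pi_gt0.
exists (Num.floor (u / (2 * pi) + 2^-1)).
have /andP[] := floor_itv (u / (2 * pi) + 2^-1).
set k := (Num.floor _)%:~R; rewrite intrD -/k => h1 h2.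
have uE : u = u / (2 * pi) * (2 * pi) by rewrite mulfVK// gt_eqF.
move: h1 h2; set x := u / _ in uE * => h1 h2.
rewrite ler_norml {1 2}uE.
have := ltW p0 => p0'.
apply/andP; split; nra.
Qed.

Lemma cos_sub_2pi (u : R) (k : int) : cos (u - 2 * pi * k%:~R) = cos u.
Proof.
have : cis (u - 2 * pi * k%:~R) = cis u by rewrite cisD cisN cis2pi_int invr1 mulr1.
by move=> [].
Qed.

Lemma le_norm_sub_2pi (t : R) (k : int) : `|t| <= pi -> `|t| <= `|t - 2 * pi * k%:~R|.
Proof.
move=> tp; have [->|k0] := eqVneq k 0; first by rewrite mulr0 subr0.
apply: (le_trans tp); have p0 := @pi_gt0 R.
have k1 : 1 <= `|k%:~R| :> R by rewrite -intr_norm ler1z -gtz0_ge1 normr_gt0.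
have h : 2 * pi <= `|2 * pi * k%:~R| :> R.
  by rewrite normrM (ger0_norm (mulr_ge0 _ (ltW p0)))// ler_peMr// mulr_ge0// ltW.
have := ler_normB (t - 2 * pi * k%:~R) t; rewrite addrAC subrr add0r normrN; lra.
Qed.

Lemma dotv_trmx m (u v : 'cV[R]_m) : dotv u v = (u^T *m v) 0 0.
Proof. by rewrite mxE; apply: eq_bigr => i _; rewrite mxE. Qed.

(** The modulus depends on the angles only modulo 2 pi, so they may be reduced to a vector s with
    entries in [- pi, pi]. For y in Y, [A *m y = e_i] makes the scalar product of y and s equal to
    t_i minus a multiple of 2 pi, hence at least |t_i| in absolute value. Averaging over Y gives
    [psi Y s >= t_i ^+ 2], so the norm of s is bounded below through rho, and [prod_Bernoulli] turns
    this into decay of the product. *)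
Lemma charfun_outer (d n : nat) (A : 'M[int]_(d, n)) (z : 'cV[R]_n)
    (Y : {fset 'cV[int]_n}) (i : 'I_d) (t : 'cV[R]_d) (rho theta alpha : R) :
  (forall j, 0 <= z j 0) -> Y != fset0 ->
  (forall y, y \in Y -> A *m y = delta_mx i 0) -> 0 < rho ->
  (forall x, psi Y x <= rho * enorm x ^+ 2) -> 1 <= theta -> 0 <= alpha ->
  (forall j, alpha <= z j 0 * (1 + z j 0)) -> `|t i 0| <= pi ->
  1 / (2 * theta) <= `|t i 0| ->
  normc (charfun (fun j => z j 0) (fun j => dotv (col j (mxR A)) t)) <=
  (1 + 2 / 5 * alpha * pi ^+ 2) ^ (- Num.floor (1 / (16 * pi ^+ 2 * rho * theta ^+ 2))).
Proof.
move=> z0 Y0 hY rho0 hpsi th1 al0 hal tpi tth.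
set u := fun j => dotv (col j (mxR A)) t.
have /choice[k hk] : forall j, exists k : int, `|u j - 2 * pi * k%:~R| <= pi.
  by move=> j; exact: mod_2pi.
pose s : 'cV[R]_n := \col_j (u j - 2 * pi * (k j)%:~R).
have sj j : s j 0 = u j - 2 * pi * (k j)%:~R by rewrite mxE.
have ys y : y \in Y -> t i 0 ^+ 2 <= dotv (mxR y) s ^+ 2.
  move=> yY.
  have -> : dotv (mxR y) s = t i 0 - 2 * pi * (\sum_j y j 0 * k j)%:~R.
    have e1 : \sum_j (y j 0)%:~R * u j = t i 0.
      have -> : \sum_j (y j 0)%:~R * u j = \sum_l ((A *m y) l 0)%:~R * t l 0.
        under eq_bigr do rewrite /u /dotv mulr_sumr.
        rewrite exchange_big; apply: eq_bigr => l _ /=.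
        rewrite mxE rmorph_sum mulr_suml; apply: eq_bigr => j _.
        by rewrite !mxE rmorphM/=; ring.
      rewrite (hY _ yY) (bigD1 i)//= big1 ?addr0 => [|l li].
        by rewrite mxE !eqxx mul1r.
      by rewrite mxE (negbTE li) mul0r.
    rewrite -e1 rmorph_sum mulr_sumr -sumrB; apply: eq_bigr => j _.
    by rewrite sj mxE rmorphM/=; ring.
  rewrite -(real_normK (num_real (t i 0))) -(real_normK (num_real (_ - _))).
  by rewrite ler_sqr ?nnegrE// le_norm_sub_2pi.
have th0 : 0 < theta by rewrite (lt_le_trans _ th1).
have p0 := @pi_gt0 R.
have psit : t i 0 ^+ 2 <= psi Y s.
  rewrite /psi ler_pdivlMl; last by rewrite ltr0n cardfs_gt0.
  have -> : #|` Y|%:R * t i 0 ^+ 2 = \sum_(y <- Y) t i 0 ^+ 2.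
    by rewrite mulr_natl big_const_seq count_predT iter_addr_0.
  by rewrite big_seq [leRHS]big_seq; apply: ler_sum => y /ys.
have ss : 1 / (4 * rho * theta ^+ 2) <= enorm s ^+ 2.
  have h : (1 / (2 * theta)) ^+ 2 <= t i 0 ^+ 2.
    rewrite -(real_normK (num_real (t i 0))) ler_sqr ?nnegrE//.
    by rewrite divr_ge0// mulr_ge0// ltW.
  have := le_trans h (le_trans psit (hpsi s)).
  rewrite -ler_pdivrMl//; apply: le_trans.
  by rewrite le_eqVlt; apply/orP; left; apply/eqP; field; rewrite !gt_eqF.
(* Half of the constant in the claim, so that [(1 + c) ^+ 2 >= 1 + 2 * c] produces its base. *)
set c := alpha * pi ^+ 2 / 5.
have c0 : 0 <= c by rewrite divr_ge0// !mulr_ge0// ltW.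
set K := 1 / (16 * pi ^+ 2 * rho * theta ^+ 2).
have K0 : 0 <= K.
  by rewrite divr_ge0// !mulr_ge0 ?exprn_ge0 ?(ltW p0) ?(ltW rho0) ?(ltW th0).
have [m mE] : exists m : nat, Num.floor K = m%:Z.
  by exists `|Num.floor K|%N; rewrite gez0_abs// floor_ge0.
have mK : m%:R <= K by have := floor_le K; rewrite mE.
rewrite mE -exprnN -[_ ^- m]div1r.
have Dm0 : 0 < (1 + 2 / 5 * alpha * pi ^+ 2) ^+ m.
  by apply: exprn_gt0; rewrite ltr_pwDl// !mulr_ge0// ltW.
rewrite div1r.
pose N := \prod_j Num.sqrt (1 + 2 * (z j 0 + z j 0 ^+ 2) * (1 - cos (u j))).
have NE : normc (charfun (fun j => z j 0) u) = N^-1.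
  by rewrite normc_prod /N -prodfV; apply: eq_bigr => j _; rewrite normc_geom_fac.
have f0 j : 0 < 1 + 2 * (z j 0 + z j 0 ^+ 2) * (1 - cos (u j)).
  by rewrite ltr_pwDl// !mulr_ge0// ?subr_ge0 ?cos_le1// addr_ge0 ?exprn_ge0.
have N0 : 0 < N by apply: prodr_gt0 => j _; rewrite sqrtr_gt0.
rewrite NE lef_pV2 ?posrE//.
rewrite -ler_sqr ?nnegrE ?(ltW Dm0) ?(ltW N0)// /N -prodrXl.
under eq_bigr do rewrite sqr_sqrtr ?(ltW (f0 _))//.
apply: (@le_trans _ _ (\prod_j (1 + c * (s j 0 / pi) ^+ 2))); last first.
  apply: ler_prod => j _; apply/andP; split.
    by rewrite addr_ge0// mulr_ge0// sqr_ge0.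
  rewrite lerD2l.
  have -> : cos (u j) = cos (s j 0) by rewrite sj cos_sub_2pi.
  have hs : s j 0 ^+ 2 / 6 <= 1 - cos (s j 0) by apply: one_sub_cos_ge; rewrite sj.
  have ha : alpha <= z j 0 + z j 0 ^+ 2 by have := hal j; rewrite mulrDr mulr1 -expr2.
  apply: (@le_trans _ _ (2 * (alpha * (s j 0 ^+ 2 / 6)))).
    rewrite /c expr_div_n.
    have -> : alpha * pi ^+ 2 / 5 * (s j 0 ^+ 2 / pi ^+ 2) = alpha * s j 0 ^+ 2 / 5.
      by move: p0; generalize (@pi R) => p p0; field; rewrite gt_eqF.
    have : 0 <= alpha * s j 0 ^+ 2 by rewrite mulr_ge0 ?sqr_ge0.
    by lra.
  rewrite -mulrA ler_wpM2l// ler_pM//.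
  by rewrite divr_ge0 ?sqr_ge0.
(* The sum of [(s j 0 / pi) ^+ 2] is at least [4 * K], hence at least [4 * m]. Of the factor 4, one
   2 is used because the squared modulus is estimated, the other to pass from [1 + c] to
   [1 + 2 * c]. *)
apply: (@le_trans _ _ ((1 + c) ^+ (4 * m))); last first.
  apply: prod_Bernoulli => //.
    move=> j; rewrite sqr_ge0/= -(real_normK (num_real _)) expr_le1//.
    by rewrite normrM normfV (ger0_norm (ltW p0)) ler_pdivrMr// mul1r sj.
  apply: (@le_trans _ _ (4 * K)); first by rewrite natrM ler_wpM2l.
  under eq_bigr do rewrite expr_div_n.
  rewrite -mulr_suml ler_pdivlMr ?exprn_gt0//.
  have -> : \sum_i0 s i0 0 ^+ 2 = enorm s ^+ 2.
    rewrite /enorm sqr_sqrtr; first by apply: eq_bigr => j _; rewrite expr2.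
    by apply: sumr_ge0 => j _; rewrite -expr2 sqr_ge0.
  apply: le_trans ss; rewrite /K le_eqVlt; apply/orP; left; apply/eqP.
  by move: p0; generalize (@pi R) => p p0; field; rewrite !gt_eqF.
rewrite -exprM mulnC exprM [leRHS]exprM.
have D0 : 0 <= 1 + 2 / 5 * alpha * pi ^+ 2.
  by rewrite addr_ge0// !mulr_ge0// ltW.
have Dc : 1 + 2 / 5 * alpha * pi ^+ 2 = 1 + 2 * c by rewrite /c; lra.
apply: lerXn2r; rewrite ?nnegrE ?D0 ?exprn_ge0 ?(addr_ge0 ler01 c0)//.
rewrite [leRHS](_ : _ = ((1 + c) ^+ 2) ^+ 2); last by rewrite -exprM.
apply: lerXn2r; rewrite ?nnegrE ?exprn_ge0 ?D0 ?(addr_ge0 ler01 c0)// Dc.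
by have := sqr_ge0 c; nra.
Qed.

End CharacteristicFunction.

(** * Finite Fourier inversion on the grid *)

Section FiniteFourier.
Context {R : realType}.
Import Normc.

Lemma cis_eq1 (x : R) : cis x = 1 -> exists k : int, x = 2 * pi * k%:~R.
Proof.
move=> x1; have [k hk] := mod_2pi x; exists k; apply/eqP; rewrite -subr_eq0.
have := one_sub_cos_ge hk; rewrite cos_sub_2pi.
have [-> _] : cos x = 1 /\ sin x = 0 by case: x1.
rewrite subrr => h; rewrite -sqrf_eq0 eq_le sqr_ge0 andbT.
by move: h; rewrite pmulr_lle0// invr_gt0.
Qed.

Section Grid.
Variable N' : nat.
Let N := N'.+1.
Variable M : nat.

Definition mesh : R := 2 * pi / N%:R.

Lemma mesh_gt0 : 0 < mesh.
Proof. by rewrite divr_gt0 ?mulr_gt0 ?pi_gt0// ltr0n. Qed.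

Lemma meshM : mesh * N%:R = 2 * pi.
Proof. by rewrite /mesh mulfVK// pnatr_eq0. Qed.

Lemma cis_mesh_pow (l : int) : cis (mesh * l%:~R) ^+ N = 1.
Proof.
by rewrite -cisMn -(cis2pi_int l) -[_ *+ N]mulr_natr mulrAC meshM.
Qed.

Lemma cis_mesh_eq1 (l : int) : (cis (mesh * l%:~R) == 1) = (N %| l)%Z.
Proof.
apply/eqP/idP => [/cis_eq1[k hk]|/dvdzP[k ->]].
  apply/dvdzP; exists k; apply/eqP; rewrite -(@eqr_int R) rmorphM/=; apply/eqP.
  have p0 : 2 * pi != 0 :> R by rewrite gt_eqF// mulr_gt0// pi_gt0.
  by apply: (mulfI p0); rewrite mulrA -hk -[RHS]/(mesh * l%:~R * N%:R) [RHS]mulrAC meshM.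
transitivity (cis (2 * pi * k%:~R : R)); last exact: cis2pi_int.
by congr cis; rewrite rmorphM/= -[LHS]/(mesh * (k%:~R * N%:R)) mulrCA meshM mulrC.
Qed.

Lemma sum_unity_root (F : fieldType) (w : F) : w ^+ N = 1 ->
  \sum_(k < N) w ^+ k = if w == 1 then N%:R else 0.
Proof.
move=> wN; case: eqP => [->|/eqP w1].
  by under eq_bigr do rewrite expr1n; rewrite sumr_const card_ord.
apply: (mulfI (x := w - 1)); first by rewrite subr_eq0.
by rewrite mulr0 -subrX1 wN subrr.
Qed.

(** Orthogonality of the characters of Z / N. The shift by M only adds a common phase, equal to 1
    when N divides l. *)
Lemma sum_cis_grid (l : int) :
  \sum_(k < N) cis (mesh * ((k : nat)%:Z - M%:Z)%:~R * l%:~R) =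
  if (N %| l)%Z then N%:R else 0.
Proof.
have E (k : 'I_N) : cis (mesh * ((k : nat)%:Z - M%:Z)%:~R * l%:~R) =
    cis (- (mesh * l%:~R * M%:R)) * cis (mesh * l%:~R) ^+ k.
  rewrite -cisMn -cisD rmorphB/= -mulr_natr; congr cis; ring.
under eq_bigr do rewrite E.
rewrite -mulr_sumr sum_unity_root ?cis_mesh_pow// cis_mesh_eq1.
case: ifP => [/dvdzP[k lE]|_]; last by rewrite mulr0.
have -> : - (mesh * l%:~R * M%:R) = 2 * pi * (- (k * M%:Z))%:~R.
  rewrite lE rmorphN/= !rmorphM/= -[mesh * _]/(mesh * (k%:~R * N%:R)) [mesh * _]mulrCA meshM.
  rewrite -[M%:~R]/(M%:R); generalize (@pi R) => p; ring.
by rewrite cis2pi_int mul1r.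
Qed.

(** At grid angles [cis (mesh * l%:~R) ^+ N = 1], so the first N terms of the geometric series sum
    to exactly 1 - q^N times the whole series, with q = z / (1 + z). *)
Lemma geom_fac_grid (z : R) (l : int) : 0 <= z ->
  geom_fac z (mesh * l%:~R) * (1 - (z / (1 + z)) ^+ N)%:C%C =
  \sum_(x < N) (1 / (1 + z) * (z / (1 + z)) ^+ x)%:C%C *
     cis (mesh * l%:~R * x%:R - z * (mesh * l%:~R)).
Proof.
move=> z0; set u := mesh * l%:~R; set q := z / (1 + z).
have z1 : 1 + z != 0 by rewrite gt_eqF// ltr_pwDl.
have E (x : 'I_N) : (1 / (1 + z) * q ^+ x)%:C%C * cis (u * x%:R - z * u) =
    (1 / (1 + z))%:C%C * cis (- (z * u)) * (q%:C%C * cis u) ^+ x.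
  rewrite [in RHS]exprMn -cisMn -rmorphXn/= cisD rmorphM/= mulr_natr; ring.
under eq_bigr do rewrite E.
rewrite -mulr_sumr.
have D0 := geom_den_neq0 u z0.
have DE : geom_den z u = (1 + z)%:C%C * (1 - q%:C%C * cis u).
  rewrite /geom_den mulrBr mulr1 mulrA -rmorphM/= /q mulrCA mulfV// mulr1 rmorphD/=.
  by rewrite rmorph1.
apply: (mulIf D0).
rewrite /geom_fac mulrAC mulfVK// DE.
have S : (1 - q%:C%C * cis u) * \sum_(i < N) (q%:C%C * cis u) ^+ i = (1 - q ^+ N)%:C%C.
  rewrite -[1 - _]opprB mulNr -subrX1 opprB exprMn cis_mesh_pow mulr1.
  by rewrite rmorphB/= rmorph1 rmorphXn.
rewrite -S.
have z1C : (1 / (1 + z))%:C%C * (1 + z)%:C%C = 1 :> R[i].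
  by rewrite -rmorphM/= div1r mulVf// rmorph1.
rewrite [RHS](_ : _ = ((1 / (1 + z))%:C%C * (1 + z)%:C%C) * (cis (- (z * u)) *
   ((1 - q%:C%C * cis u) * \sum_(i < N) (q%:C%C * cis u) ^+ i))); last by ring.
by rewrite z1C mul1r.
Qed.

(* For N = 2 * M + 1 the points mesh *: gridpt k fill [- pi, pi]^d. *)
Definition gridpt d (k : {ffun 'I_d -> 'I_N}) : 'cV[int]_d :=
  \col_i ((k i : nat)%:Z - M%:Z).

Definition natvec n (x : {ffun 'I_n -> 'I_N}) : 'cV[int]_n :=
  \col_j (x j : nat)%:Z.

(** Probability that independent geometric variables with means [z j 0] take the values x. *)
Definition geom_weight n (z : 'cV[R]_n) (x : 'I_n -> nat) : R :=
  \prod_j (1 / (1 + z j 0) * (z j 0 / (1 + z j 0)) ^+ x j).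

(** Expanding the product of the series of [geom_fac_grid] gives a sum over x in a box; since A z =
    b, the centering phases combine into that of b. Orthogonality in each coordinate of k keeps the
    x with A x = b modulo N. *)
Lemma fourier_grid d n (A : 'M[int]_(d, n)) (b : 'cV[int]_d) (z : 'cV[R]_n) :
  (forall j, 0 <= z j 0) -> mxR A *m z = mxR b ->
  (\sum_(k : {ffun 'I_d -> 'I_N}) charfun (fun j => z j 0)
     (fun j => dotv (col j (mxR A)) (mesh *: mxR (gridpt k)))) *
  (\prod_j (1 - (z j 0 / (1 + z j 0)) ^+ N))%:C%C =
  (N%:R ^+ d * \sum_(x : {ffun 'I_n -> 'I_N} |
     [forall i, (N %| ((A *m natvec x - b) i 0)%R)%Z]) geom_weight z (fun j => x j))%:C%C.
Proof.
move=> z0 Azb.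
have udot k j : dotv (col j (mxR A)) (mesh *: mxR (gridpt k)) =
    mesh * ((A^T *m gridpt k) j 0)%:~R.
  rewrite /dotv mxE rmorph_sum mulr_sumr; apply: eq_bigr => i _.
  by rewrite !mxE rmorphM/=; ring.
have phase k (x : {ffun 'I_n -> 'I_N}) :
    \sum_j (mesh * ((A^T *m gridpt k) j 0)%:~R * (x j)%:R
      - z j 0 * (mesh * ((A^T *m gridpt k) j 0)%:~R)) =
    \sum_i mesh * ((k i : nat)%:Z - M%:Z)%:~R * ((A *m natvec x - b) i 0)%:~R.
  have e j : mesh * ((A^T *m gridpt k) j 0)%:~R * (x j)%:R
      - z j 0 * (mesh * ((A^T *m gridpt k) j 0)%:~R) =
      \sum_i mesh * ((k i : nat)%:Z - M%:Z)%:~R * ((A i j)%:~R * ((x j)%:R - z j 0)).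
    rewrite [z j 0 * _]mulrC -mulrBr !mxE rmorph_sum mulr_sumr mulr_suml.
    by apply: eq_bigr => i _; rewrite !mxE rmorphM/=; ring.
  under eq_bigr do rewrite e.
  rewrite exchange_big; apply: eq_bigr => i _ /=; rewrite -mulr_sumr; congr (_ * _).
  rewrite !mxE rmorphB/= rmorph_sum.
  have -> : (b i 0)%:~R = \sum_j (A i j)%:~R * z j 0.
    move: Azb => /matrixP/(_ i 0); rewrite !mxE => <-.
    by apply: eq_bigr => j _; rewrite mxE.
  rewrite -sumrB; apply: eq_bigr => j _.
  by rewrite mxE rmorphM/= mulrBr.
have step k : charfun (fun j => z j 0)
     (fun j => dotv (col j (mxR A)) (mesh *: mxR (gridpt k))) *
    (\prod_j (1 - (z j 0 / (1 + z j 0)) ^+ N))%:C%C =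
    \sum_(x : {ffun 'I_n -> 'I_N}) (geom_weight z (fun j => x j))%:C%C *
     \prod_i cis (mesh * ((k i : nat)%:Z - M%:Z)%:~R * ((A *m natvec x - b) i 0)%:~R).
  rewrite rmorph_prod -big_split/=.
  under eq_bigr do rewrite udot geom_fac_grid//.
  rewrite bigA_distr_bigA; apply: eq_bigr => x _.
  by rewrite big_split/= /geom_weight rmorph_prod -!cis_sum phase.
rewrite mulr_suml.
rewrite (eq_bigr _ (fun k _ => step k)).
rewrite exchange_big/= rmorphM/= rmorph_sum mulr_sumr [RHS]big_mkcond/=.
apply: eq_bigr => x _; rewrite -mulr_sumr.
rewrite -(bigA_distr_bigA (fun i (k : 'I_N) =>
  cis (mesh * ((k : nat)%:Z - M%:Z)%:~R * ((A *m natvec x - b) i 0)%:~R))).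
under [X in _ * X]eq_bigr do rewrite sum_cis_grid.
case: ifP => [/forallP H|/negbT].
  under eq_bigr do rewrite H.
  by rewrite prodr_const card_ord mulrC rmorphXn/= rmorph_nat.
rewrite negb_forall => /existsP[i Hi].
by rewrite (bigD1 i)//= (negbTE Hi) mul0r mulr0.
Qed.

End Grid.
End FiniteFourier.

(** * Weights of integer points and stationarity of the entropy *)

Section GeometricWeights.
Context {R : realType}.

Lemma sum_geom (L : nat) (z : R) : 0 <= z ->
  \sum_(x < L) 1 / (1 + z) * (z / (1 + z)) ^+ x = 1 - (z / (1 + z)) ^+ L.
Proof.
move=> z0; have z1 : 1 + z != 0 by rewrite gt_eqF// ltr_pwDl.
rewrite -mulr_sumr -[RHS]opprB subrX1 -mulNr; congr (_ * _); by field.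
Qed.

Lemma geom_weight_ge0 n (z : 'cV[R]_n) (x : 'I_n -> nat) :
  (forall j, 0 <= z j 0) -> 0 <= geom_weight z x.
Proof.
move=> z0; apply: prodr_ge0 => j _.
by rewrite mulr_ge0 ?exprn_ge0 ?divr_ge0 ?addr_ge0.
Qed.

(** The total weight is at most 1, and the weight of the box of side L factors over the
    coordinates. *)
Lemma geom_weight_tail n N' L (z : 'cV[R]_n) : (forall j, 0 <= z j 0) ->
  (L <= N'.+1)%N ->
  \sum_(x : {ffun 'I_n -> 'I_N'.+1} | ~~ [forall j, (x j < L)%N])
     geom_weight z (fun j => x j) <= 1 - \prod_j (1 - (z j 0 / (1 + z j 0)) ^+ L).
Proof.
move=> z0 LN.
have q0 j : 0 <= z j 0 / (1 + z j 0) by rewrite divr_ge0// addr_ge0.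
have q1 j : z j 0 / (1 + z j 0) <= 1.
  by rewrite ler_pdivrMr ?ltr_pwDl// mul1r lerDr.
have all1 : \sum_(x : {ffun 'I_n -> 'I_N'.+1}) geom_weight z (fun j => x j) <= 1.
  rewrite -(bigA_distr_bigA (fun j (x : 'I_N'.+1) => 1 / (1 + z j 0) * (z j 0 / (1 + z j 0)) ^+ x)).
  apply: prodr_ile1 => j _.
  by rewrite sum_geom// subr_ge0 exprn_ile1//= lerBlDr lerDl exprn_ge0.
have small : \sum_(x : {ffun 'I_n -> 'I_N'.+1} | [forall j, (x j < L)%N])
     geom_weight z (fun j => x j) = \prod_j (1 - (z j 0 / (1 + z j 0)) ^+ L).
  rewrite big_mkcond/=.
  transitivity (\prod_j \sum_(x < N'.+1)
      if (x < L)%N then 1 / (1 + z j 0) * (z j 0 / (1 + z j 0)) ^+ x else 0).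
    rewrite bigA_distr_bigA; apply: eq_bigr => x _.
    case: ifP => [/forallP h|/negbT]; first by apply: eq_bigr => j _; rewrite h.
    rewrite negb_forall => /existsP[j hj].
    by rewrite [RHS](bigD1 j)//= (negbTE hj) mul0r.
  apply: eq_bigr => j _; rewrite -big_mkcond/= -sum_geom//.
  by rewrite (big_ord_widen _ (fun x => 1 / (1 + z j 0) * (z j 0 / (1 + z j 0)) ^+ x) LN).
move: all1; rewrite (bigID (fun x : {ffun 'I_n -> 'I_N'.+1} => [forall j, (x j < L)%N]))/=.
by rewrite small => h; rewrite lerBrDl.
Qed.

Lemma is_derive_mul_ln (c y t : R) : 0 < c + t * y ->
  is_derive t 1 (fun t => (c + t * y) * ln (c + t * y)) (y * (ln (c + t * y) + 1)).
Proof.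
move=> h.
have Hl : is_derive t 1 (fun t : R => c + t * y) y.
  by apply: is_derive_eq; rewrite /GRing.scale/=; ring.
have Hc := @is_derive1_comp R (@ln R) (fun t => c + t * y) t _ _ (is_derive1_ln h) Hl.
have := is_deriveM Hl Hc => Hm.
apply: (@is_derive_eq _ _ _ _ _ _ _ _ Hm); rewrite /GRing.scale/=.
by field; rewrite gt_eqF.
Qed.

Section Lagrange.
Variables (d n : nat) (A : 'M[int]_(d, n)) (b : 'cV[int]_d) (z : 'cV[R]_n).
Hypothesis zmax : maximizes entropy (polyhedron A b) z.
Hypothesis z0 : forall j, 0 < z j 0.

(** As z has positive coordinates, z + t y stays in P for small |t|, and the derivative of the
    entropy along y vanishes at its maximum. *)
Lemma entropy_stationary (y : 'cV[R]_n) : mxR A *m y = 0 ->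
  \sum_j y j 0 * (ln (z j 0 + 1) - ln (z j 0)) = 0.
Proof.
move=> Ay0.
have [e [e0 he]] : exists e : R, 0 < e /\ forall j, e * `|y j 0| < z j 0.
  (* The summand 1 in the denominator covers the coordinates where y vanishes. *)
  pose m := \big[Num.min/1]_j (z j 0 / (1 + `|y j 0|)).
  have m0 : 0 < m.
    by rewrite /m; elim/big_ind: _ => // [u v u0 v0|j _];
      rewrite ?lt_min ?u0//= divr_gt0// ltr_pwDl.
  exists m; split=> // j.
  have mj : m <= z j 0 / (1 + `|y j 0|) by exact: bigmin_le_cond.
  apply: (@lt_le_trans _ _ (m * (1 + `|y j 0|))).
    by rewrite ltr_pM2l// ltrDr.
  by rewrite -ler_pdivlMr// ltr_pwDl.
pose f t := \sum_j ((z j 0 + t * y j 0 + 1) * ln (z j 0 + t * y j 0 + 1)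
   - (z j 0 + t * y j 0) * ln (z j 0 + t * y j 0)).
have pos t j : t \in `]- e, e[ -> 0 < z j 0 + t * y j 0.
  rewrite in_itv/= -ltr_norml => te.
  have := he j; have : `|t * y j 0| <= e * `|y j 0|.
    by rewrite normrM ler_wpM2r// ltW.
  have := ler_norm (- (t * y j 0)); rewrite normrN; lra.
have fE t : f t = entropy (z + t *: y).
  by apply: eq_bigr => j _; rewrite !mxE.
have D t : t \in `]- e, e[ -> is_derive t 1 f
    (\sum_j y j 0 * (ln (z j 0 + t * y j 0 + 1) - ln (z j 0 + t * y j 0))).
  move=> te.
  have -> : f = \sum_j (fun t => (z j 0 + 1 + t * y j 0) * ln (z j 0 + 1 + t * y j 0)
     - (z j 0 + t * y j 0) * ln (z j 0 + t * y j 0)).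
    apply/funext => u; rewrite /f fct_sumE; apply: eq_bigr => j _.
    by rewrite [z j 0 + 1 + _]addrAC.
  apply: is_derive_sum => j.
  have p0 := pos t j te.
  have p1 : 0 < z j 0 + 1 + t * y j 0 by lra.
  have := is_deriveB (is_derive_mul_ln p1) (is_derive_mul_ln p0).
  by move=> h; apply: is_derive_eq; rewrite [z j 0 + 1 + _]addrAC; ring.
have max0 : is_derive (0 : R) 1 f 0.
  apply: (@derive1_at_max R f (- e) e); rewrite ?in_itv/= ?oppr_lt0 ?e0//.
  - by lra.
  - by move=> t /D [].
  - move=> t te; rewrite !fE scale0r addr0; apply: zmax.2; split.
      by rewrite mulmxDr -scalemxAr Ay0 scaler0 addr0; case: zmax => -[].
    by move=> j; rewrite !mxE; apply: ltW; exact: pos.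
have D0 : is_derive (0:R) 1 f (\sum_j y j 0 * (ln (z j 0 + 0 * y j 0 + 1) - ln (z j 0 + 0 * y j 0))).
  by apply: D; rewrite in_itv/= oppr_lt0 e0.
have e1 := @derive_val _ _ _ _ _ _ _ D0.
have e2 := @derive_val _ _ _ _ _ _ _ max0.
rewrite -[RHS]e2 e1; apply: eq_bigr => j _; by rewrite mul0r addr0.
Qed.

(** The logarithm of the weight is affine in x, and by stationarity its linear part vanishes on the
    kernel of A. It is thus constant on the solutions of A x = b, and its value at z is minus the
    entropy. *)
Lemma geom_weight_entropy (x : 'cV[int]_n) (k : 'I_n -> nat) :
  A *m x = b -> (forall j, x j 0 = (k j)%:Z) ->
  geom_weight z k = expR (- entropy z).
Proof.
move=> Axb xk.
have [[Azb _] _] := zmax.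
have y0 : mxR A *m (mxR x - z) = 0.
  by rewrite mulmxBr Azb -map_mxM Axb subrr.
have := entropy_stationary y0.
under eq_bigr do rewrite 2!mxE xk mxE.
move=> st.
rewrite /geom_weight /entropy -[LHS]addr0.
have -> : \prod_j (1 / (1 + z j 0) * (z j 0 / (1 + z j 0)) ^+ k j) =
   expR (\sum_j (- ln (z j 0 + 1) + (k j)%:R * (ln (z j 0) - ln (z j 0 + 1)))).
  rewrite expR_sum; apply: eq_bigr => j _.
  have zj := z0 j; have z1 : 0 < z j 0 + 1 by rewrite ltr_wpDr.
  rewrite expRD expRN lnK ?posrE// div1r addrC expRM_natl expRB !lnK ?posrE//.
rewrite addr0; congr expR; rewrite -[LHS]addr0 -[X in _ + X = _]st -big_split -sumrN/=.
apply: eq_bigr => j _; rewrite -[(k j)%:~R]/((k j)%:R); ring.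
Qed.

End Lagrange.
End GeometricWeights.

(** * The number of integer points as a limit of grid sums *)

Section GridMass.
Context {R : realType}.

Section Polyhedron.
Variables (d n : nat) (A : 'M[int]_(d, n)) (b : 'cV[int]_d).
Let P : set 'cV[R]_n := polyhedron A b.

Lemma bounded_coord (B : set 'cV[R]_n) : bounded_set B ->
  exists C : nat, forall x, B x -> forall j, `|x j 0| <= C%:R.
Proof.
move=> [C [_ hC]].
exists `|Num.ceil (`|C| + 1)|%N => x Bx j.
have xC : `|x| <= `|C| + 1 by apply: (hC (`|C| + 1)) => //; have := ler_norm C; lra.
have xj : `|x j 0| <= `|x|.
  by rewrite [leRHS]mx_normrE; exact: (le_bigmax _ (fun ij => `|x ij.1 ij.2|) (j, 0)).
apply: (le_trans xj); apply: (le_trans xC).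
apply: (le_trans (ceil_ge _)); rewrite natr_absz ler_int; exact: ler_norm.
Qed.

(** A zero column would put the whole ray from z in direction e_j into P. This later excludes d = 0
    and zero coordinates of z. *)
Lemma bounded_polyhedron_col_neq0 (z : 'cV[R]_n) j : bounded_set P -> P z ->
  col j (mxR A) != 0 :> 'cV[R]_d.
Proof.
move=> /bounded_coord[C hC] [Az z0]; apply/eqP => Aj.
have Px : P (z + (C%:R + 1) *: delta_mx j 0).
  split; first by rewrite mulmxDr -scalemxAr -colE Aj scaler0 addr0.
  by move=> i; rewrite !mxE addr_ge0// mulr_ge0// addr_ge0.
have := hC _ Px j; rewrite !mxE !eqxx mulr1 ger0_norm; last first.
  by rewrite addr_ge0// addr_ge0.
by have := z0 j; lra.
Qed.

Lemma nb_int_pointsE N' :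
  (forall x : 'cV[int]_n, P (mxR x) -> forall j, x j 0 < N'.+1) ->
  nb_int_points P = #|[pred x : {ffun 'I_n -> 'I_N'.+1} | A *m natvec x == b]|.
Proof.
move=> hN.
set T := [pred x : {ffun 'I_n -> 'I_N'.+1} | A *m natvec x == b].
have inj : injective (@natvec N' n).
  move=> x y /matrixP e; apply/ffunP => j; apply: val_inj.
  by have := e j 0; rewrite !mxE => -[].
rewrite /nb_int_points.
have -> : [set x : 'cV[int]_n | P (mxR x)] = [set` [fset natvec x | x in T]%fset].
  apply/seteqP; split => x /=.
    move=> Px; have x0 j : 0 <= x j 0 by have := Px.2 j; rewrite mxE ler0z.
    have xN := hN _ Px.
    have xx j : (`|x j 0%R| < N'.+1)%N by have := xN j; have := x0 j; lia.
    apply/imfsetP; exists [ffun j => Ordinal (xx j)] => /=.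
      rewrite inE; apply/eqP.
      have -> : natvec [ffun j => Ordinal (xx j)] = x.
        by apply/matrixP => i k; rewrite ord1 !mxE ffunE/= gez0_abs.
      have := Px.1; rewrite -map_mxM => /matrixP e.
      by apply/matrixP => i k; have := e i k; rewrite !mxE => /intr_inj.
    by apply/matrixP => i k; rewrite ord1 !mxE ffunE/= gez0_abs.
  move=> /imfsetP[y /=]; rewrite inE => /eqP yb ->.
  split; first by rewrite -map_mxM yb.
  by move=> j; rewrite !mxE.
rewrite set_fsetK card_imfset//= -cardE.
by apply: eq_card => x; rewrite !inE.
Qed.

(** On the box of side L all entries of A x - b are bounded by a fixed K, and a multiple of a larger
    N bounded by K is 0. *)
Lemma small_multiple_eq0 (L : nat) : exists K : nat, forall N' (x : {ffun 'I_n -> 'I_N'.+1}),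
  (K <= N')%N -> (forall j, (x j < L)%N) ->
  [forall i, (N'.+1 %| ((A *m natvec x - b) i 0)%R)%Z] -> A *m natvec x = b.
Proof.
exists (\sum_i (\sum_j `|A i j| * L + `|b i 0%R|))%N => N' x KN xL /forallP dv.
apply/eqP; rewrite -subr_eq0; apply/eqP/matrixP => i k; rewrite ord1 [RHS]mxE.
have := dv i; rewrite dvdzE/= => /dvdn_leq h.
apply/eqP; rewrite -absz_eq0; apply: contraT; rewrite -lt0n => /h.
rewrite leqNgt ltnS (leq_trans _ KN)//.
rewrite (bigD1 i)//= (leq_trans _ (leq_addr _ _))//.
rewrite !mxE; apply: (leq_trans (leqD_dist _ 0 _)).
rewrite subr0 sub0r abszN leq_add2r.
elim/big_rec2: _ => // j y1 y2 _ h2.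
apply: (@leq_trans (`|(A i j * natvec x j 0)%R| + `|y1|)%N).
  by move: (A i j * natvec x j 0 : int) (y1 : int) => a c; lia.
rewrite leq_add// mxE abszM leq_mul2l/= ltnW ?orbT//; exact: xL.
Qed.

Hypothesis bndP : bounded_set P.
Variable z : 'cV[R]_n.
Hypothesis zmax : maximizes entropy P z.
Hypothesis z0 : forall j, 0 < z j 0.

Let q j := z j 0 / (1 + z j 0).

Lemma cvg_prod_geom : \prod_j (1 - q j ^+ L) @[L --> \oo] --> (1 : R).
Proof.
suff : \prod_j (1 - q j ^+ L) @[L --> \oo] --> \prod_(j < n) (1 - 0 : R).
  by rewrite [X in _ --> X]big1 // => j _; rewrite subr0.
apply: (@cvg_big R 'I_n *%R 1 xpredT (@mul_continuous _) nat \oo (index_enum _)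
  (fun j L => 1 - q j ^+ L) (fun=> 1 - 0)) => j _.
apply: cvgB; first exact: cvg_cst.
have zj := z0 j; have z1 : 0 < 1 + z j 0 by lra.
apply: cvg_expr; rewrite ger0_norm ?divr_ge0 ?(ltW zj) ?(ltW z1)//.
by rewrite /q ltr_pdivrMr// mul1r; lra.
Qed.

Let S N' := \sum_(x : {ffun 'I_n -> 'I_N'.+1} |
     [forall i, (N'.+1 %| ((A *m natvec x - b) i 0)%R)%Z]) geom_weight z (fun j => x j).
Let mass : R := (nb_int_points P)%:R * expR (- entropy z).

(** Solutions of the congruence are true solutions, all of the same weight, or spurious ones. For
    large N the latter leave the box of side L, so their weight is at most the tail. N0 makes the
    grid box contain every integer point of P. *)
Lemma grid_mass_bounds : exists N0, forall L, exists N1, forall N', (N0 <= N')%N -> (N1 <= N')%N ->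
  mass <= S N' <= mass + (1 - \prod_j (1 - q j ^+ L)).
Proof.
have [C hC] := bounded_coord bndP.
exists C => L; have [K hK] := small_multiple_eq0 L.
exists (maxn K L) => N' CN; rewrite geq_max => /andP[KN LN].
have zge0 j : 0 <= z j 0 by exact: ltW.
have mE : mass = \sum_(x : {ffun 'I_n -> 'I_N'.+1} | A *m natvec x == b) geom_weight z (fun j => x j).
  rewrite (eq_bigr (fun=> expR (- entropy z))) => [|x /eqP xb].
    rewrite sumr_const /mass (@nb_int_pointsE N') ?mulr_natl// => x Px j.
    have := hC _ Px j; rewrite mxE -intr_norm => h.
    have : `|x j 0| <= C%:Z by rewrite -(ler_int R).
    lia.
  by apply: (geom_weight_entropy zmax z0 xb) => j; rewrite mxE.
have sub (x : {ffun 'I_n -> 'I_N'.+1}) : A *m natvec x == b ->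
    [forall i, (N'.+1 %| ((A *m natvec x - b) i 0)%R)%Z].
  by move=> /eqP ->; apply/forallP => i; rewrite subrr mxE dvdz0.
rewrite /S (bigID (fun x => A *m natvec x == b))/=.
rewrite (eq_bigl (fun x => A *m natvec x == b)); last first.
  by move=> x /=; case: eqP => xb; rewrite ?andbF// andbT sub//; apply/eqP.
rewrite -mE lerDl lerD2l sumr_ge0 => [/=|x _]; last exact: geom_weight_ge0.
apply: (le_trans _ (@geom_weight_tail R n N' L z zge0 _)); last exact: leqW.
rewrite [leLHS]big_mkcond [leRHS]big_mkcond; apply: ler_sum => x _ /=.
case: ifP => [/andP[dv nb]|_]; last by case: ifP => // _; exact: geom_weight_ge0.
case: ifP => // /negbFE/forallP xL.
by move: nb; rewrite (hK N' x KN xL dv) eqxx.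
Qed.

Lemma cvg_grid_mass : S N' @[N' --> \oo] --> mass.
Proof.
have [N0 hN] := grid_mass_bounds.
apply/cvgrPdist_le => e e0.
move/cvgrPdist_le: cvg_prod_geom => /(_ e e0) [L _ hL].
have := hL L (leqnn L); rewrite /= => /ler_normlP[_ hl].
have [N1 hN1] := hN L.
exists (maxn N0 N1) => // N' /=; rewrite geq_max => /andP[a c].
have /andP[l u] := hN1 N' a c.
by rewrite ler_norml; apply/andP; split; lra.
Qed.

(** In [fourier_grid] both the normalizing product and the weight of the congruence class converge,
    and neither involves M, so one N0 serves every M. *)
Lemma fourier_limit : forall e, 0 < e -> exists N0, forall N' M, (N0 <= N')%N ->
  `| mesh N' ^+ d * complex.Re (\sum_(k : {ffun 'I_d -> 'I_N'.+1}) charfun (fun j => z j 0)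
     (fun j => dotv (col j (mxR A)) (mesh N' *: mxR (gridpt M k))))
     - (2 * pi) ^+ d * mass| <= e.
Proof.
move=> e e0.
have C : (2 * pi) ^+ d * (S N' / \prod_j (1 - q j ^+ N'.+1)) @[N' --> \oo] --> (2 * pi) ^+ d * (mass / 1).
  apply: cvgM; first exact: cvg_cst.
  apply: cvgM; first exact: cvg_grid_mass.
  apply: cvgV => //.
  have := cvg_prod_geom; rewrite -(cvg_shiftS (fun L => \prod_j (1 - q j ^+ L))).
  exact.
rewrite divr1 in C.
move/cvgrPdist_le: C => /(_ e e0) [N0 _ hN0].
exists N0 => N' M /hN0; rewrite /= distrC.
congr (`|_ - _| <= e).
have zge0 j : 0 <= z j 0 by exact: ltW.
have Azb : mxR A *m z = mxR b by case: zmax => -[].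
have := @fourier_grid R N' M d n A b z zge0 Azb.
set X := \sum_(k : {ffun _ -> _}) _; set Pi := \prod_j _ => F.
have Pi0 : Pi != 0.
  apply/prodf_neq0 => j _; rewrite gt_eqF// subr_gt0.
  have zj := z0 j; have z1 : 0 < 1 + z j 0 by lra.
  by rewrite exprn_ilt1// ?divr_ge0 ?(ltW zj) ?(ltW z1)// ltr_pdivrMr// mul1r; lra.
have {}F : complex.Re X * Pi = N'.+1%:R ^+ d * S N'.
  have := congr1 (@complex.Re R) F.
  by case: (X) => x y /=; rewrite mulr0 subr0.
rewrite -(@meshM R N') exprMn -[LHS]mulrA; congr (_ * _).
by rewrite mulrA -F mulfK.
Qed.

End Polyhedron.
End GridMass.

(** * Pointwise comparison with the Gaussian *)

Section PointwiseEstimate.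
Context {R : realType}.
Import Normc.

Lemma expR_le_1D2x (x : R) : 0 <= x <= 2^-1 -> expR x <= 1 + 2 * x.
Proof.
move=> /andP[x0 x1]; have := @expR_ge1Dx R (- x); rewrite expRN => h.
have e0 := @expR_gt0 R x.
have {h} : (1 - x) * expR x <= 1 by rewrite -ler_pdivlMr// div1r.
have : 0 <= x * (1 - 2 * x) by rewrite mulr_ge0//; lra.
have := @expR_ge1Dx R x.
nra.
Qed.

Section Local.
Variables (d n : nat) (A : 'M[int]_(d, n)) (z : 'cV[R]_n) (lambda theta : R).
Hypothesis z0 : forall j, 0 <= z j 0.
Hypothesis lam0 : 0 < lambda.
Hypothesis lamq : forall t : 'cV[R]_d, lambda * enorm t ^+ 2 <= qform A z t.
Hypothesis th1 : 1 <= theta.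
Hypothesis Ath : forall j, norm1 (col j (mxR A)) <=
  theta * Num.sqrt (z j 0 / (1 + z j 0) ^+ 3).

Let u (t : 'cV[R]_d) j := dotv (col j (mxR A)) t.

Lemma qformE t : qform A z t = \sum_j (z j 0 + z j 0 ^+ 2) * u t j ^+ 2 / 2.
Proof. by rewrite /qform mulrC mulr_suml. Qed.

Lemma enorm_sqr m (t : 'cV[R]_m) : enorm t ^+ 2 = \sum_i t i 0 ^+ 2.
Proof.
rewrite /enorm sqr_sqrtr; first by apply: eq_bigr => j _; rewrite expr2.
by apply: sumr_ge0 => j _; rewrite -expr2 sqr_ge0.
Qed.

Lemma coord_sqr_le m (t : 'cV[R]_m) i : t i 0 ^+ 2 <= enorm t ^+ 2.
Proof.
rewrite enorm_sqr (bigD1 i)//= lerDl; apply: sumr_ge0 => j _; exact: sqr_ge0.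
Qed.

Lemma qform_ge0 t : 0 <= qform A z t.
Proof. by apply: le_trans (lamq t); rewrite mulr_ge0 ?sqr_ge0// ltW. Qed.

(** Duality of the l1 and sup norms; this is the hypothesis of the local estimates with
    [w = theta * s]. *)
Lemma dotv_col_sqr_le (t : 'cV[R]_d) (s : R) j : (forall i, `|t i 0| <= s) ->
  0 <= s -> u t j ^+ 2 <= (theta * s) ^+ 2 * (z j 0 / (1 + z j 0) ^+ 3).
Proof.
move=> ts s0; set w := z j 0 / _.
have w0 : 0 <= w by rewrite divr_ge0 ?exprn_ge0 ?addr_ge0.
have th0 : 0 <= theta by apply: le_trans th1.
have h : `|u t j| <= theta * Num.sqrt w * s.
  apply: (@le_trans _ _ (norm1 (col j (mxR A)) * s)); last by rewrite ler_wpM2r.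
  rewrite /u /dotv /norm1 mulr_suml; apply: (le_trans (ler_norm_sum _ _ _)).
  by apply: ler_sum => i _; rewrite normrM ler_wpM2l.
rewrite -(real_normK (num_real (u t j))) -[w]sqr_sqrtr// -exprMn.
by rewrite ler_sqr ?nnegrE ?mulr_ge0 ?sqrtr_ge0// mulrAC.
Qed.

(** Chernoff majorant of exp (- q) on the set where some |t_i| >= s0: there one of the two
    exponential factors in t_i is at least 1. *)
Definition coord_tail (eta s0 : R) (t : 'cV[R]_d) : R :=
  \sum_i (expR (- qform A z t + eta * t i 0 - eta * s0) +
          expR (- qform A z t - eta * t i 0 - eta * s0)).

Lemma coord_tail_ge (eta s0 : R) (t : 'cV[R]_d) (i : 'I_d) : 0 <= eta -> s0 <= `|t i 0| ->
  expR (- qform A z t) <= coord_tail eta s0 t.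
Proof.
move=> eta0 st; rewrite /coord_tail (bigD1 i)//=.
set a := expR _; set b := expR _; set c := expR _.
have S0 : 0 <= \sum_(j < d | j != i) (expR (- qform A z t + eta * t j 0 - eta * s0) +
          expR (- qform A z t - eta * t j 0 - eta * s0)).
  by apply: sumr_ge0 => j _; rewrite addr_ge0 ?expR_ge0.
apply: (@le_trans _ _ (b + c)); last by rewrite lerDl.
have b0 : 0 <= b := expR_ge0 _; have c0 : 0 <= c := expR_ge0 _.
have [ti|ti] := leP 0 (t i 0).
  have : a <= b by rewrite ler_expR; move: st; rewrite ger0_norm// => st; nra.
  lra.
have : a <= c by rewrite ler_expR; move: st; rewrite ltr0_norm// => st; nra.
lra.
Qed.

(** Let s be the largest |t_i| and [w = theta * s]. If [w > 2^-1], D bounds F and [coord_tail]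
    bounds the Gaussian. Otherwise |F| <= exp (- q / 2), so for [q > K] both terms are at most exp
    (- K / 4) exp (- q / 4). For [q <= K] and [s <= s0] the local comparison applies; for [q <= K]
    and [s > s0], |F| <= 3 exp (- q), whence the coefficient 4. *)
Lemma charfun_pointwise (eps s0 K eta D : R) (t : 'cV[R]_d) :
  (0 < d)%N -> 0 < eps -> eps <= 2^-1 -> 0 <= s0 -> theta * s0 <= 2^-1 ->
  0 <= K -> 8 * K * (theta * s0) <= eps / 8 -> theta ^+ 2 * K ^+ 2 / lambda <= 2^-1 ->
  0 <= eta -> 0 <= D ->
  (forall i, 1 / (2 * theta) <= `|t i 0| -> normc (charfun (fun j => z j 0) (u t)) <= D) ->
  normc (charfun (fun j => z j 0) (u t) - (expR (- qform A z t))%:C%C) <=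
  eps / 3 * expR (- qform A z t) + 4 * coord_tail eta s0 t
  + 2 * expR (- (K / 4)) * expR (- (qform A z t / 4)) + D.
Proof.
move=> d0 eps0 eps1 s00 ths0 K0 Ks0 KL eta0 D0 hD.
set q := qform A z t; set F := charfun _ _.
have q0 : 0 <= q := qform_ge0 t.
have th0 : 0 < theta by apply: lt_le_trans th1.
have [i [hs s_ge0]] : exists i, (forall j, `|t j 0| <= `|t i 0|) /\ 0 <= `|t i 0|.
  have i0 : 'I_d by exists 0%N.
  exists [arg max_(j > i0) `|t j 0|]%O; split => //.
  by case: arg_maxP => // k _ hk j; exact: hk.
set s := `|t i 0| in hs s_ge0.
pose w := theta * s.
have w0 : 0 <= w by rewrite mulr_ge0// ltW.
have uw j := dotv_col_sqr_le j hs s_ge0; rewrite -/w in uw.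
have qE : q = \sum_j (z j 0 + z j 0 ^+ 2) * u t j ^+ 2 / 2 by exact: qformE.
have T1 : 0 <= eps / 3 * expR (- q) by rewrite mulr_ge0 ?expR_ge0// divr_ge0// ltW.
have T2 : 0 <= coord_tail eta s0 t.
  by apply: sumr_ge0 => j _; rewrite addr_ge0 ?expR_ge0.
have T3 : 0 <= 2 * expR (- (K / 4)) * expR (- (q / 4)) by rewrite !mulr_ge0 ?expR_ge0.
have tri : normc (F - (expR (- q))%:C%C) <= normc F + expR (- q).
  apply: (le_trans (normcD _ _)); rewrite normcN lerD2l.
  by rewrite /normc /= expr0n addr0 sqrtr_sqr ger0_norm ?expR_ge0.
have [w2|w2] := leP w 2^-1; last first.
  have h1 : 1 / (2 * theta) <= `|t i 0|.
    by rewrite ler_pdivrMr ?mulr_gt0//; move: w2; rewrite /w /s; lra.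
  have h2 : s0 <= `|t i 0|.
    by rewrite -(ler_pM2l th0) (le_trans ths0)// ltW.
  have := hD i h1; have := coord_tail_ge eta0 h2; rewrite -/q -/F; lra.
have w2q : w ^+ 2 <= 4^-1.
  by have -> : 4^-1 = 2^-1 ^+ 2 :> R; [field|rewrite ler_sqr ?nnegrE].
have normF : normc F <= expR (- q * (1 - 13 / 12 * w ^+ 2)).
  have := @normc_charfun_le R n (fun j => z j 0) (u t) z0 w uw.
  by rewrite -qE.
have [qK|Kq] := leP q K; last first.
  have hF : normc F <= expR (- (q / 2)).
    apply: (le_trans normF); rewrite ler_expR; nra.
  have hq : expR (- q) <= expR (- (q / 2)) by rewrite ler_expR; lra.
  have : expR (- (q / 2)) <= expR (- (K / 4)) * expR (- (q / 4)).
    by rewrite -expRD ler_expR; lra.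
  lra.
have [ss0|s0s] := leP s s0.
  have H := @charfun_sub_gauss R n (fun j => z j 0) (u t) z0 w w0 uw.
  rewrite -qE -/F -/q in H.
  have x8 : 8 * q * w <= eps / 8.
    apply: le_trans Ks0; apply: ler_pM => //; first exact: mulr_ge0.
      by rewrite ler_wpM2l.
    by rewrite /w ler_wpM2l// ltW.
  set x := 8 * q * w in x8 H.
  have x0 : 0 <= x by apply: mulr_ge0 => //; apply: mulr_ge0.
  have xb : 13 / 12 * w ^+ 2 * q <= x.
    rewrite /x; have : 0 <= q * w by rewrite mulr_ge0.
    rewrite expr2 => h; nra.
  have ex : expR x <= 1 + 2 * x by apply: expR_le_1D2x; rewrite x0/=; lra.
  have ex1 : 1 <= expR x by rewrite -expR0 ler_expR.
  apply: (le_trans H).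
  have h1 : expR (- q + 13 / 12 * w ^+ 2 * q) * (expR x - 1) <=
       expR (- q) * ((1 + 2 * x) * (2 * x)).
    rewrite expRD -mulrA ler_wpM2l ?expR_ge0//.
    rewrite ler_pM ?expR_ge0 ?subr_ge0//.
      by apply: le_trans ex; rewrite ler_expR.
    by lra.
  have h2 : (1 + 2 * x) * (2 * x) <= eps / 3 by nra.
  have := ler_wpM2l (expR_ge0 (- q)) h2.
  lra.
have hF : normc F <= 3 * expR (- q).
  apply: (le_trans normF).
  have -> : - q * (1 - 13 / 12 * w ^+ 2) = 13 / 12 * w ^+ 2 * q + - q by ring.
  rewrite expRD ler_wpM2r ?expR_ge0//.
  (* Since [lambda * s ^+ 2 <= q <= K], the product is at most [theta ^+ 2 * K ^+ 2 / lambda]. *)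
  have wq : w ^+ 2 * q <= 2^-1.
    have s2 : s ^+ 2 * lambda <= q.
      apply: le_trans (lamq t); rewrite mulrC ler_wpM2l ?(ltW lam0)//.
      by rewrite /s real_normK ?num_real// coord_sqr_le.
    apply: le_trans KL; rewrite ler_pdivlMr//.
    have -> : w ^+ 2 * q * lambda = theta ^+ 2 * (s ^+ 2 * lambda * q) by rewrite /w; ring.
    rewrite ler_wpM2l ?sqr_ge0// expr2; apply: ler_pM => //.
      by rewrite mulr_ge0 ?sqr_ge0// ltW.
    exact: le_trans s2 qK.
  have y0 : 0 <= w ^+ 2 * q by rewrite mulr_ge0 ?sqr_ge0.
  (* The exponent may reach 13 / 24, just beyond the range of [expR_le_1D2x]; in that case the bound
     is applied to half of it and squared. *)
  have [y1|y1] := leP (13 / 12 * w ^+ 2 * q) 2^-1.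
    have : expR (13 / 12 * w ^+ 2 * q) <= 1 + 2 * (13 / 12 * w ^+ 2 * q).
      by apply: expR_le_1D2x; rewrite y1 andbT -mulrA mulr_ge0.
    lra.
  have : expR (13 / 12 * w ^+ 2 * q) = expR (13 / 24 * w ^+ 2 * q) ^+ 2.
    by rewrite [RHS]expr2 -expRD; congr expR; lra.
  have : expR (13 / 24 * w ^+ 2 * q) <= 1 + 2 * (13 / 24 * w ^+ 2 * q).
    by apply: expR_le_1D2x; lra.
  have := expR_ge0 (13 / 24 * w ^+ 2 * q).
  move: (expR (13 / 24 * w ^+ 2 * q)) (expR (13 / 12 * w ^+ 2 * q)) => a c a0 a1 ->.
  nra.
have := coord_tail_ge eta0 (ltW s0s); rewrite -/q; lra.
Qed.

End Local.
End PointwiseEstimate.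

(** * Summation of the pointwise bound over the grid *)

Section GridSummation.
Context {R : realType}.
Import Normc.

Lemma posdef_unitmx d (Q : 'M[R]_d) : posdefmx Q -> Q \in unitmx.
Proof.
by move=> /gauss_esum_near[detQ _]; rewrite unitmxE unitfE gt_eqF.
Qed.

Lemma esum_grid_split d N' M (a : 'cV[int]_d -> R) : (forall k, 0 <= a k) ->
  (\esum_(k in [set: 'cV[int]_d]) (a k)%:E =
   (\sum_(k : {ffun 'I_d -> 'I_N'.+1}) a (gridpt M k))%:E +
   \esum_(k in ~` range (@gridpt N' M d)) (a k)%:E)%E.
Proof.
move=> a0.
rewrite (esumID (range (@gridpt N' M d))); last by move=> k _; rewrite lee_fin.
rewrite !setTI; congr (_ + _)%E.
rewrite esum_image; last first.
  move=> x y _ _ /matrixP e; apply/ffunP => i; apply: val_inj.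
  by have := e i 0; rewrite !mxE => /addIr -[].
rewrite esum_fset//; last by move=> k _; rewrite lee_fin.
have -> : [set: {ffun 'I_d -> 'I_N'.+1}] = [set` index_enum {ffun 'I_d -> 'I_N'.+1}].
  by apply/seteqP; split => // x _ /=; exact: mem_index_enum.
rewrite -fsbig_seq ?index_enum_uniq// sumEFin//.
exact: finite_finset.
Qed.

Lemma notin_range_gridpt d M (k : 'cV[int]_d) :
  (~` range (@gridpt (2 * M)%N M d)) k -> exists i, M%:Z < `|k i 0|.
Proof.
move=> nk; apply: contrapT => /forallNP h; apply: nk.
have hk i : `|k i 0| <= M%:Z by have := h i; move=> /negP; rewrite -leNgt.
have lt i : (`|(k i 0%R + M%:Z)%R| < (2 * M).+1)%N by have := hk i; lia.
exists [ffun i => Ordinal (lt i)] => //.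
apply/matrixP => i j; rewrite ord1 mxE ffunE/=.
by have := hk i; lia.
Qed.

Lemma dist_half_le (k M : nat) : (k < (2 * M).+1)%N -> `|k%:Z - M%:Z| <= M%:Z.
Proof. lia. Qed.

Lemma qfZ d (c : R) (Q : 'M[R]_d) (t : 'cV[R]_d) : qf (c *: Q) t = c * qf Q t.
Proof. by rewrite /qf -scalemxAr -scalemxAl mxE. Qed.

Lemma qf_shift d (Q : 'M[R]_d) (t u : 'cV[R]_d) : Q^T = Q ->
  qf Q (t - u) = qf Q t - 2 * (t^T *m (Q *m u)) 0 0 + qf Q u.
Proof.
move=> Qs; rewrite /qf.
have -> : (t - u)^T = t^T - u^T by apply/matrixP => i j; rewrite !mxE.
have e : u^T *m Q *m t = t^T *m Q *m u.
  transitivity ((u^T *m Q *m t)^T); last by rewrite !trmx_mul trmxK Qs mulmxA.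
  by rewrite (row_col_scalar (u^T *m Q) t) tr_scalar_mx.
rewrite mulmxBl mulmxBr !mulmxBl e mulmxA.
move: (t^T *m Q *m t) (u^T *m Q *m u) (t^T *m Q *m u) => a b c.
by rewrite !mxE; ring.
Qed.

Section Chernoff.
Variables (d : nat) (Q : 'M[R]_d) (lambda : R).
Hypothesis pdQ : posdefmx Q.
Hypothesis lam0 : 0 < lambda.
Hypothesis lamQ : forall t, lambda * enorm t ^+ 2 <= qf Q t / 2.

(** Completing the square with u = c Q^(-1) e_i. Then [qf Q u = c * u i 0], and coercivity bounds
    u_i by itself: [lambda * u_i ^+ 2 <= c * u_i / 2]. *)
Lemma linear_tilt (c : R) (i : 'I_d) : exists u : 'cV[R]_d,
  (forall t, - (qf Q t / 2) + c * t i 0 = qf Q u / 2 - qf Q (t - u) / 2) /\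
  qf Q u / 2 <= c ^+ 2 / (4 * lambda).
Proof.
pose u : 'cV[R]_d := invmx Q *m (c *: delta_mx i 0).
have Qu : Q *m u = c *: delta_mx i 0 by rewrite mulKVmx// posdef_unitmx.
have tu t : (t^T *m (Q *m u)) 0 0 = c * t i 0.
  by rewrite Qu -scalemxAr mxE -colE !mxE.
exists u; split.
  by move=> t; rewrite qf_shift ?pdQ.1// tu; lra.
have qu : qf Q u = c * u i 0 by rewrite /qf -mulmxA tu.
have := lamQ u; rewrite qu => h.
have : lambda * u i 0 ^+ 2 <= c * u i 0 / 2.
  by apply: le_trans h; rewrite ler_wpM2l ?(ltW lam0)// coord_sqr_le.
move: (u i 0) => y hy.
rewrite ler_pdivlMr ?mulr_gt0//.
have : 0 <= (c - 2 * lambda * y) ^+ 2 by exact: sqr_ge0.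
have := ler_wpM2l (ltW lam0) hy.
rewrite !expr2; nra.
Qed.

End Chernoff.

Section Core.
Variables (d n : nat) (A : 'M[int]_(d, n)) (b : 'cV[int]_d) (z : 'cV[R]_n)
  (lambda theta : R).
Let P : set 'cV[R]_n := polyhedron A b.
Let B : 'M[R]_(d, n) := scaledmx A z.
Let Q : 'M[R]_d := B *m B^T.
Hypothesis bndP : bounded_set P.
Hypothesis zmax : maximizes entropy P z.
Hypothesis zpos : forall j, 0 < z j 0.
Hypothesis d0 : (0 < d)%N.
Hypothesis lam0 : 0 < lambda.
Hypothesis lamq : forall t : 'cV[R]_d, lambda * enorm t ^+ 2 <= qform A z t.
Hypothesis th1 : 1 <= theta.
Hypothesis Ath : forall j, norm1 (col j (mxR A)) <=
  theta * Num.sqrt (z j 0 / (1 + z j 0) ^+ 3).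

Lemma qf_scaledmx (t : 'cV[R]_d) : qf Q t / 2 = qform A z t.
Proof.
rewrite /qform mulrC; congr (_ * _).
have -> : qf Q t = ((B^T *m t)^T *m (B^T *m t)) 0 0.
  by rewrite /qf /Q trmx_mul trmxK !mulmxA.
rewrite -dotv_trmx; apply: eq_bigr => j _.
have -> : (B^T *m t) j 0 = Num.sqrt (z j 0 ^+ 2 + z j 0) * dotv (col j (mxR A)) t.
  rewrite mxE /dotv mulr_sumr; apply: eq_bigr => i _.
  by rewrite !mxE mulrA.
rewrite -expr2 exprMn sqr_sqrtr; first by rewrite addrC.
by rewrite addr_ge0 ?sqr_ge0// ltW.
Qed.

Lemma posdef_scaledmx : posdefmx Q.
Proof.
split; first by rewrite /Q trmx_mul trmxK.
move=> t t0.
have [i ti] : exists i, t i 0 != 0.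
  apply: contrapT => /forallNP h; move/eqP: t0; apply.
  by apply/matrixP => i j; rewrite ord1 mxE; apply/eqP; have := h i; move/negP; rewrite negbK.
have : 0 < qf Q t / 2.
  rewrite qf_scaledmx; apply: lt_le_trans (lamq t); rewrite mulr_gt0//.
  apply: lt_le_trans (coord_sqr_le t i); rewrite lt_neqAle sqr_ge0 andbT eq_sym.
  by rewrite sqrf_eq0.
by rewrite pmulr_lgt0// invr_gt0.
Qed.

Lemma posdefmxZ (c : R) : 0 < c -> posdefmx (c *: Q).
Proof.
move=> c0; split; first by rewrite linearZ/= posdef_scaledmx.1.
move=> t t0; rewrite qfZ mulr_gt0//.
exact: posdef_scaledmx.2.
Qed.

Lemma gauss_mass_quarter : gauss_mass (4^-1 *: Q) = 2 ^+ d * gauss_mass Q.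
Proof.
have [detQ _] := gauss_esum_near posdef_scaledmx.
rewrite /gauss_mass detZ.
have -> : 2 ^+ d = Num.sqrt ((2 ^+ d) ^+ 2) :> R.
  by rewrite sqrtr_sqr ger0_norm// exprn_ge0.
rewrite -sqrtrM ?sqr_ge0//; congr Num.sqrt.
have -> : (2 ^+ d) ^+ 2 = 4 ^+ d :> R by rewrite -exprM mulnC exprM; congr (_ ^+ d); ring.
rewrite invfM exprVn invrK; ring.
Qed.

Variables eps s0 K D : R.
Hypothesis eps0 : 0 < eps.
Hypothesis eps1 : eps <= 2^-1.
Hypothesis s0_ge0 : 0 <= s0.
Hypothesis ths0 : theta * s0 <= 2^-1.
Hypothesis K0 : 0 <= K.
Hypothesis Ks0 : 8 * K * (theta * s0) <= eps / 8.
Hypothesis KL : theta ^+ 2 * K ^+ 2 / lambda <= 2^-1.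
Hypothesis D0 : 0 <= D.
Hypothesis hD : forall (t : 'cV[R]_d) i, `|t i 0| <= pi -> 1 / (2 * theta) <= `|t i 0| ->
  normc (charfun (fun j => z j 0) (fun j => dotv (col j (mxR A)) t)) <= D.
Hypothesis tail1 : 10 * d%:R * expR (- (lambda * s0 ^+ 2)) <= eps / 3.
Hypothesis tail2 : 2 * 2 ^+ d * expR (- (K / 4)) <= eps / 3.

Let G := gauss_mass Q.
(** Minimizes [eta ^+ 2 / (4 * lambda) - eta * s0], with value [- (lambda * s0 ^+ 2)]. *)
Let eta := 2 * lambda * s0.
Let mass : R := (nb_int_points P)%:R * expR (- entropy z).

Lemma eta_ge0 : 0 <= eta.
Proof. by rewrite !mulr_ge0// ltW. Qed.

(** By [linear_tilt] each of the 2 d tilted terms is a scalar times a translated Gaussian, which is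
    why the hypothesis is needed for every shift u. *)
Lemma esum_coord_tail_le h e : 0 < h -> 0 <= e ->
  (forall u : 'cV[R]_d, (\esum_(k in [set: 'cV[int]_d])
      (h ^+ d * expR (- (qf Q (h *: mxR k + u) / 2)))%:E <= (G + e)%:E)%E) ->
  (\esum_(k in [set: 'cV[int]_d]) (h ^+ d * coord_tail A z eta s0 (h *: mxR k))%:E <=
   (2 * d%:R * expR (- (lambda * s0 ^+ 2)) * (G + e))%:E)%E.
Proof.
move=> h0 e0 hu.
have lamQ t : lambda * enorm t ^+ 2 <= qf Q t / 2 by rewrite qf_scaledmx.
have tilt c i : c ^+ 2 = eta ^+ 2 ->
   (\esum_(k in [set: 'cV[int]_d])
     (h ^+ d * expR (- qform A z (h *: mxR k) + c * (h *: mxR k : 'cV[R]_d) i 0 - eta * s0))%:E <=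
   (expR (- (lambda * s0 ^+ 2)) * (G + e))%:E)%E.
  move=> ce; have [u [hu1 hu2]] := linear_tilt posdef_scaledmx lam0 lamQ c i.
  have -> : (\esum_(k in [set: 'cV[int]_d])
     (h ^+ d * expR (- qform A z (h *: mxR k) + c * (h *: mxR k : 'cV[R]_d) i 0 - eta * s0))%:E =
     \esum_(k in [set: 'cV[int]_d])
     (expR (qf Q u / 2 - eta * s0))%:E * (h ^+ d * expR (- (qf Q (h *: mxR k + - u) / 2)))%:E)%E.
    apply: eq_esum => k _; rewrite -EFinM; congr (_%:E).
    rewrite -qf_scaledmx hu1 mulrCA -expRD; congr (_ * expR _); ring.
  rewrite esumZl ?expR_ge0//; last first.
    by move=> k; rewrite lee_fin mulr_ge0 ?expR_ge0 ?exprn_ge0// ltW.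
  rewrite EFinM; apply: lee_pmul.
  - by rewrite lee_fin expR_ge0.
  - by apply: esum_ge0 => k _; rewrite lee_fin mulr_ge0 ?expR_ge0 ?exprn_ge0// ltW.
  - rewrite lee_fin ler_expR; move: hu2; rewrite ce /eta => h2.
    have -> : lambda * s0 ^+ 2 = 2 * lambda * s0 * s0 - (2 * lambda * s0) ^+ 2 / (4 * lambda).
      by field; rewrite gt_eqF.
    lra.
  - exact: hu.
rewrite /coord_tail.
have hd0 : 0 <= h ^+ d by rewrite exprn_ge0// ltW.
under eq_esum.
  move=> k _; rewrite mulr_sumr -sumEFin.
  under eq_bigr do rewrite mulrDr EFinD.
  over.
rewrite esum_sum; last first.
  by move=> k i _ _; rewrite adde_ge0// lee_fin mulr_ge0 ?expR_ge0.
apply: (@le_trans _ _ (\sum_(i < d) (2 * (expR (- (lambda * s0 ^+ 2)) * (G + e)))%:E)%E).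
  apply: lee_sum => i _.
  rewrite esumD; first last.
  - by move=> k _; rewrite lee_fin mulr_ge0 ?expR_ge0.
  - by move=> k _; rewrite lee_fin mulr_ge0 ?expR_ge0.
  rewrite mulr_natl mulr2n EFinD; apply: leeD.
    exact: (tilt eta i erefl).
  apply: le_trans (tilt (- eta) i (sqrrN _)); apply: le_esum => k _.
  by rewrite mulNr.
rewrite sumEFin lee_fin sumr_const card_ord -mulr_natl.
by rewrite le_eqVlt; apply/orP; left; apply/eqP; ring.
Qed.

(** Each majorant of [charfun_pointwise] is summed over the finite grid and bounded by its sum over
    the infinite one. Gaussian mass outside the cube is again a coordinate tail, since [s0 <= pi].
    The constant D is counted once per grid point, and [h ^+ d] times their number is
    [(2 * pi) ^+ d]. *)
Lemma charfun_grid_sum_le (M : nat) (e h : R) : 0 < h ->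
  h * (2 * M).+1%:R = 2 * pi -> 0 < e ->
  (forall u : 'cV[R]_d, ((G - e)%:E <= \esum_(k in [set: 'cV[int]_d])
      (h ^+ d * expR (- (qf Q (h *: mxR k + u) / 2)))%:E <= (G + e)%:E)%E) ->
  (\esum_(k in [set: 'cV[int]_d])
      (h ^+ d * expR (- (qf (4^-1 *: Q) (h *: mxR k) / 2)))%:E <= (2 ^+ d * G + e)%:E)%E ->
  `| h ^+ d * complex.Re (\sum_(k : {ffun 'I_d -> 'I_(2 * M).+1}) charfun (fun j => z j 0)
     (fun j => dotv (col j (mxR A)) (h *: mxR (gridpt M k)))) - G |
  <= eps * G + (2 * pi) ^+ d * D + 4 * e.
Proof.
move=> h0 meshM1 e0 hG hQ.
have hd0 : 0 <= h ^+ d by rewrite exprn_ge0// ltW.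
pose T := {ffun 'I_d -> 'I_(2 * M).+1}.
pose t (k : T) : 'cV[R]_d := h *: mxR (gridpt M k).
pose F k := charfun (fun j => z j 0) (fun j => dotv (col j (mxR A)) (t k)).
pose E k := expR (- qform A z (t k)).
have hG0 : ((G - e)%:E <= \esum_(k in [set: 'cV[int]_d])
      (h ^+ d * expR (- qform A z (h *: mxR k)))%:E <= (G + e)%:E)%E.
  have := hG 0; under eq_esum => k _ do rewrite addr0 qf_scaledmx.
  by [].
have tails := esum_coord_tail_le h0 (ltW e0) (fun u => proj2 (andP (hG u))).
set c1 := 2 * d%:R * _ in tails.
have split1 := @esum_grid_split d (2 * M)%N M (fun k => h ^+ d * expR (- qform A z (h *: mxR k)))
  (fun k => mulr_ge0 hd0 (expR_ge0 _)).
have tail_ge0 k : 0 <= h ^+ d * coord_tail A z eta s0 (h *: mxR k).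
  rewrite mulr_ge0//; apply: sumr_ge0 => i _; by rewrite addr_ge0 ?expR_ge0.
have split2 := @esum_grid_split d (2 * M)%N M (fun k => h ^+ d * coord_tail A z eta s0 (h *: mxR k)) tail_ge0.
have split3 := @esum_grid_split d (2 * M)%N M (fun k => h ^+ d * expR (- (qf (4^-1 *: Q) (h *: mxR k) / 2)))
  (fun k => mulr_ge0 hd0 (expR_ge0 _)).
set BE := \sum_(k : T) _ in split1; set BC := \sum_(k : T) _ in split2;
set BQ := \sum_(k : T) _ in split3.
have pi2 : 2 <= pi :> R := pi_ge2 R.
have s0pi : s0 <= pi.
  have h1 : s0 <= theta * s0 by rewrite ler_peMl.
  by apply: (le_trans h1); apply: (le_trans ths0); apply: le_trans pi2; lra.
(* Used for m = M + 1: as [h * (2 * M).+1%:R = 2 * pi], points outside the grid have a coordinate of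
   size at least pi. *)
have stepM (m : nat) : (2 * M < 2 * m)%N -> pi <= h * m%:R.
  move=> Mm; have := @ler_wpM2l R h (ltW h0) (2 * M).+1%:R (2 * m)%:R.
  by rewrite ler_nat => /(_ Mm); rewrite meshM1 natrM mulrCA ler_pM2l.
have stepM' (m : nat) : (m <= M)%N -> h * m%:R <= pi.
  move=> Mm; have := @ler_wpM2l R h (ltW h0) (2 * m)%:R (2 * M).+1%:R.
  by rewrite ler_nat meshM1 natrM mulrCA ler_pM2l//; apply; rewrite leqW// leq_mul2l Mm orbT.
have outle : (\esum_(k in ~` range (@gridpt (2 * M)%N M d))
     (h ^+ d * expR (- qform A z (h *: mxR k)))%:E <= (c1 * (G + e))%:E)%E.
  apply: le_trans tails; rewrite split2.
  apply: (@le_trans _ _ (\esum_(k in ~` range (@gridpt (2 * M)%N M d))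
     (h ^+ d * coord_tail A z eta s0 (h *: mxR k))%:E)%E); last first.
    by rewrite leeDr// lee_fin sumr_ge0.
  apply: le_esum => k /notin_range_gridpt[i ki]; rewrite lee_fin ler_wpM2l//.
  apply: (@coord_tail_ge R d n A z eta s0 _ i); first exact: eta_ge0.
  apply: (le_trans s0pi); rewrite !mxE normrM (gtr0_norm h0) -intr_norm.
  have h2 : (M.+1%:Z)%:~R <= (`|k i 0|)%:~R :> R by rewrite ler_int.
  apply: le_trans (ler_wpM2l (ltW h0) h2).
  by apply: (stepM M.+1); rewrite ltn_pmul2l.
have BEu : BE <= G + e.
  have /andP[_] := hG0; rewrite split1 -lee_fin; apply: le_trans.
  by rewrite leeDl// esum_ge0// => k _; rewrite lee_fin mulr_ge0 ?expR_ge0.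
have BEl : G - e - c1 * (G + e) <= BE.
  have /andP[+ _] := hG0; rewrite split1 => hl.
  rewrite lerBlDr -lee_fin [leRHS]EFinD; apply: (le_trans hl); exact: leeD.
have BCu : BC <= c1 * (G + e).
  rewrite -lee_fin; apply: le_trans tails; rewrite split2.
  by rewrite leeDl// esum_ge0// => k _; rewrite lee_fin.
have BQu : BQ <= 2 ^+ d * G + e.
  rewrite -lee_fin; apply: le_trans hQ; rewrite split3.
  by rewrite leeDl// esum_ge0// => k _; rewrite lee_fin mulr_ge0 ?expR_ge0.
have tpi (k : T) i : `|t k i 0| <= pi.
  rewrite !mxE normrM (gtr0_norm h0) -intr_norm.
  have kM : `|(k i : nat)%:Z - M%:Z| <= M%:Z by exact: dist_half_le (ltn_ord (k i)).
  have h2 : (`|(k i : nat)%:Z - M%:Z|)%:~R <= (M%:Z)%:~R :> R by rewrite ler_int.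
  by apply: (le_trans (ler_wpM2l (ltW h0) h2)); exact: (stepM' M).
have pw k : normc (F k - (E k)%:C%C) <= eps / 3 * E k + 4 * coord_tail A z eta s0 (t k)
    + 2 * expR (- (K / 4)) * expR (- (qf (4^-1 *: Q) (t k) / 2)) + D.
  have -> : qf (4^-1 *: Q) (t k) / 2 = qform A z (t k) / 4.
    by rewrite -qf_scaledmx qfZ; ring.
  apply: (@charfun_pointwise R d n A z lambda theta (fun j => ltW (zpos j)) lam0 lamq th1 Ath) => //.
    exact: eta_ge0.
  by move=> i; apply: hD.
have diff : `|h ^+ d * complex.Re (\sum_k F k) - BE| <=
   eps / 3 * BE + 4 * BC + 2 * expR (- (K / 4)) * BQ + (2 * pi) ^+ d * D.
  have -> : h ^+ d * complex.Re (\sum_k F k) - BE = h ^+ d * complex.Re (\sum_k (F k - (E k)%:C%C)).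
    rewrite sumrB -rmorph_sum /BE -mulr_sumr -mulrBr; congr (_ * _).
    by case: (\sum_k F k) => x y /=.
  rewrite normrM (ger0_norm hd0).
  apply: (@le_trans _ _ (h ^+ d * \sum_k normc (F k - (E k)%:C%C))).
    rewrite ler_wpM2l//.
    apply: (@le_trans _ _ (normc (\sum_k (F k - (E k)%:C%C)))).
      case: (\sum_k _) => x y /=; rewrite -sqrtr_sqr ler_wsqrtr// lerDl sqr_ge0//.
    elim/big_rec2: _ => [|k y1 y2 _ IH]; first by rewrite normc0.
    by apply: (le_trans (normcD _ _)); rewrite lerD2l.
  have -> : (2 * pi) ^+ d * D = \sum_(k : T) h ^+ d * D.
    rewrite sumr_const card_ffun !card_ord -[RHS]mulr_natl natrX mulrA -exprMn.
    by rewrite [_ * h]mulrC meshM1.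
  rewrite !mulr_sumr -!big_split/=; apply: ler_sum => k _.
  have := ler_wpM2l hd0 (pw k); rewrite /E /t; lra.
have G0 : 0 <= G by exact: sqrtr_ge0.
have c10 : 0 <= c1 by rewrite !mulr_ge0 ?expR_ge0.
(* Four from the coefficient of [coord_tail], one from the Gaussian mass outside the grid. *)
have c1e : 5 * c1 <= eps / 3 by rewrite /c1; move: tail1; lra.
have k2 := tail2.
set c2 := expR (- (K / 4)) in diff k2 *.
have c20 : 0 <= c2 := expR_ge0 _.
have d21 : 1 <= 2 ^+ d :> R by apply: exprn_ege1; lra.
have c2e : 2 * c2 <= eps / 3.
  apply: le_trans k2; have := ler_wpM2l c20 d21; lra.
have D2 : `|h ^+ d * complex.Re (\sum_k F k) - G| <=
   `|h ^+ d * complex.Re (\sum_k F k) - BE| + `|BE - G|.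
  by have := ler_normD (h ^+ d * complex.Re (\sum_k F k) - BE) (BE - G); rewrite addrA subrK.
apply: (le_trans D2).
have BG : `|BE - G| <= e + c1 * (G + e).
  have : 0 <= c1 * (G + e) by rewrite mulr_ge0// addr_ge0// ltW.
  by rewrite ler_norml => ?; apply/andP; split; lra.
have q2 : c2 * BQ <= c2 * (2 ^+ d * G + e) by rewrite ler_wpM2l.
have q1 : eps * BE <= eps * (G + e) by rewrite ler_wpM2l// ltW.
have q3 := ler_wpM2r G0 k2.
have q4 := ler_wpM2r G0 c1e.
have q5 := ler_wpM2r (ltW e0) c1e.
have q6 := ler_wpM2r (ltW e0) c2e.
have q7 := ler_wpM2r (ltW e0) eps1.
lra.
Qed.

Lemma mass_estimate : `|(2 * pi) ^+ d * mass - G| <= eps * G + (2 * pi) ^+ d * D.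
Proof.
apply/ler_addgt0Pr => e e0.
(* Four fifths are used by [charfun_grid_sum_le], one by [fourier_limit]. *)
have e5 : 0 < e / 5 by rewrite divr_gt0.
have [_ /(_ _ e5) near1] := gauss_esum_near posdef_scaledmx.
have q4 : 0 < 4^-1 :> R by [].
have [_ /(_ _ e5) near2] := gauss_esum_near (posdefmxZ q4).
have [r /= r0 hr] : \forall h \near (0 : R)^'+,
  (forall u : 'cV[R]_d, ((G - e / 5)%:E <= \esum_(k in [set: 'cV[int]_d])
      (h ^+ d * expR (- (qf Q (h *: mxR k + u) / 2)))%:E <= (G + e / 5)%:E)%E) /\
  (\esum_(k in [set: 'cV[int]_d])
      (h ^+ d * expR (- (qf (4^-1 *: Q) (h *: mxR k) / 2)))%:E <= (2 ^+ d * G + e / 5)%:E)%E.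
  near=> h; split; first by near: h.
  have : forall u : 'cV[R]_d, ((gauss_mass (4^-1 *: Q) - e / 5)%:E <= \esum_(k in [set: 'cV[int]_d])
      (h ^+ d * expR (- (qf (4^-1 *: Q) (h *: mxR k + u) / 2)))%:E <= (gauss_mass (4^-1 *: Q) + e / 5)%:E)%E.
    by near: h.
  move=> /(_ 0)/andP[_]; rewrite gauss_mass_quarter.
  by under eq_esum => k _ do rewrite addr0.
have [N0 hN0] := fourier_limit bndP zmax zpos e5.
pose M := maxn N0 (Num.bound (2 * pi / r)).
have hM : mesh (2 * M)%N < r :> R.
  have x0 : 0 <= 2 * pi / r by rewrite divr_ge0 ?mulr_ge0 ?pi_ge0// ltW.
  have bM : (Num.bound (2 * pi / r))%:R <= (2 * M).+1%:R :> R.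
    by rewrite ler_nat leqW// (leq_trans (leq_maxr N0 _))// leq_pmull.
  have := lt_le_trans (archi_boundP x0) bM.
  by rewrite ltr_pdivrMr// => h; rewrite /mesh ltr_pdivrMr ?ltr0n// [ltRHS]mulrC.
have m0 := @mesh_gt0 R (2 * M)%N.
have [|hG hQ] := hr (mesh (2 * M)%N) _ m0.
  by rewrite /= sub0r normrN gtr0_norm.
have E1 := charfun_grid_sum_le m0 (@meshM R (2 * M)%N) e5 hG hQ.
have NM : (N0 <= 2 * M)%N.
  by rewrite (@leq_trans M)// ?leq_maxl// leq_pmull.
have E2 := hN0 _ M NM.
set a := mesh _ ^+ d * _ in E1 E2.
have -> : (2 * pi) ^+ d * mass - G = (a - G) - (a - (2 * pi) ^+ d * mass).
  by rewrite opprB [RHS]addrC addrA subrK.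
apply: (le_trans (ler_normB _ _)).
apply: (le_trans (lerD E1 E2)).
by rewrite -addrA lerD2l; lra.
Unshelve. all: by end_near. Qed.

End Core.
End GridSummation.

(** * Choice of parameters and form of the result *)

Section Constants.
Context {R : realType}.
Import Normc.

Lemma le_normD_split (x a c : R) : 0 <= a -> 0 <= c -> `|x| <= a + c ->
  exists y y' : R, [/\ x = y + y', `|y| <= a & `|y'| <= c].
Proof.
move=> a0 c0; rewrite ler_norml => /andP[xl xu].
have [xa|xa] := leP x (- a).
  exists (- a), (x + a); split; [ring|by rewrite normrN ger0_norm|].
  by rewrite ler_norml; apply/andP; split; lra.
have [xa'|xa'] := leP x a.
  by exists x, 0; rewrite addr0 normr0; split=> //; rewrite ler_norml (ltW xa).
exists a, (x - a); split; [ring|by rewrite ger0_norm|].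
by rewrite ler_norml; apply/andP; split; lra.
Qed.

(** The error is cut into a part of size at most [eps * G0], absorbed by kappa, and a remainder that
    becomes Delta. *)
Lemma mass_error_split (mass G0 eps D : R) : 0 < G0 -> 0 <= eps -> 0 <= D ->
  `|mass - G0| <= eps * G0 + D ->
  exists kappa Delta, [/\ mass = kappa * G0 + Delta,
    1 - eps <= kappa <= 1 + eps & `|Delta| <= D].
Proof.
move=> G00 e0 D0 /(le_normD_split (mulr_ge0 e0 (ltW G00)) D0)[y [y' [e ya yD]]].
exists (1 + y / G0), y'; split=> //.
  by rewrite mulrDl mul1r mulfVK ?gt_eqF// -addrA -e addrC subrK.
by rewrite lerD2l lerD2l -ler_norml normrM normfV (gtr0_norm G00) ler_pdivrMr.
Qed.

Lemma powR_half_sqrt (a : R) (d : nat) : 0 <= a -> a `^ (d%:R / 2) = Num.sqrt (a ^+ d).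
Proof. by move=> a0; rewrite powRrM powR_mulrn// powR12_sqrt// exprn_ge0. Qed.

Lemma gauss_massE d (Q : 'M[R]_d) : 0 < \det Q ->
  gauss_mass Q = (2 * pi) ^+ d * (1 / ((2 * pi) `^ (d%:R / 2) * Num.sqrt (\det Q))).
Proof.
move=> Q0; have p0 : 0 < 2 * pi :> R by rewrite mulr_gt0// pi_gt0.
have pd0 : 0 <= (2 * pi) ^+ d :> R by rewrite exprn_ge0// ltW.
rewrite powR_half_sqrt ?(ltW p0)// /gauss_mass sqrtrM// sqrtrV ?(ltW Q0)//.
have s0 : Num.sqrt ((2 * pi) ^+ d) != 0 :> R by rewrite gt_eqF// sqrtr_gt0 exprn_gt0.
rewrite -{2}(sqr_sqrtr pd0).
have q0 : Num.sqrt (\det Q) != 0 by rewrite gt_eqF// sqrtr_gt0.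
by move: s0 q0; move: (Num.sqrt ((2 * pi) ^+ d)) (Num.sqrt (\det Q)) => a c a0 c0; field; rewrite c0 a0.
Qed.

(* The hypothesis on lambda amounts to
   C * theta * (d + ln (1 / eps)) * sqrt (ln (n / eps) / lambda) <= eps. *)
Lemma parameter_bounds (d n : nat) (C eps lambda theta : R) : C = 16 * 16 * 8 ->
  (0 < d)%N -> (d < n)%N -> 0 < eps -> eps <= 2^-1 -> 1 <= theta ->
  C ^+ 2 * eps ^- 2 * theta ^+ 2 * (d%:R + ln (1 / eps)) ^+ 2
    * ln (n%:R / eps) <= lambda ->
  let s0 := 2 * Num.sqrt (ln (n%:R / eps) / lambda) in
  let K := 16 * (d%:R + ln (1 / eps)) in
  [/\ 0 < lambda, theta * s0 <= 2^-1 & 0 <= K] /\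
  [/\ 8 * K * (theta * s0) <= eps / 8, theta ^+ 2 * K ^+ 2 / lambda <= 2^-1,
    10 * d%:R * expR (- (lambda * s0 ^+ 2)) <= eps / 3 &
    2 * 2 ^+ d * expR (- (K / 4)) <= eps / 3].
Proof.
move=> CE d0 dn e0 e1 th1; set L := ln (1 / eps); set La := ln (n%:R / eps).
move=> hl s0 K.
have d1 : 1 <= d%:R :> R by rewrite ler1n.
have n2 : 2 <= n%:R :> R by rewrite ler_nat (leq_trans _ dn).
have n0 : 0 < n%:R :> R by lra.
have ne0 : 0 < n%:R / eps by rewrite divr_gt0.
have C0 : 0 < C by rewrite CE !mulr_gt0.
have L0 : 0 <= L by rewrite ln_ge0// ler_pdivlMr// mul1r; lra.
have La2 : 2^-1 <= La.
  rewrite -ler_expR /La lnK ?posrE//.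
  have h : expR 2^-1 <= 1 + 2 * 2^-1 :> R by apply: expR_le_1D2x; lra.
  by apply: (le_trans h); rewrite ler_pdivlMr//; lra.
have La0 : 0 < La by lra.
set x := d%:R + L in hl K *.
have x1 : 1 <= x by rewrite /x; lra.
have th0 : 0 < theta by lra.
have hl2 : C ^+ 2 * theta ^+ 2 * x ^+ 2 * La <= eps ^+ 2 * lambda.
  rewrite -ler_pdivrMl ?exprn_gt0//; apply: le_trans hl.
  by rewrite le_eqVlt; apply/orP; left; apply/eqP; ring.
have tx1 : 1 <= theta ^+ 2 * x ^+ 2 by rewrite -exprMn exprn_ege1// mulr_ege1.
have e2 : eps ^+ 2 <= 1.
  by rewrite exprn_ile1 ?(ltW e0)// (le_trans e1)// invf_le1 ?ler1n.
have lam0 : 0 < lambda.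
  have : 0 < eps ^+ 2 * lambda.
    apply: lt_le_trans hl2; rewrite mulr_gt0// -mulrA mulr_gt0 ?exprn_gt0//.
    exact: lt_le_trans tx1.
  by rewrite pmulr_rgt0// exprn_gt0.
set r := Num.sqrt (La / lambda) in s0 *.
have r0 : 0 <= r by exact: sqrtr_ge0.
have r2 : r ^+ 2 = La / lambda by rewrite sqr_sqrtr// divr_ge0// ltW.
(* For [K = 16 * x] and [s0 = 2 * r], [8 * K * (theta * s0)] is [16 * 16 * theta * x * r]; the last
   factor 8 of C yields [eps / 8]. *)
have main : C * theta * x * r <= eps.
  rewrite -ler_sqr ?nnegrE ?(ltW e0)//; last first.
    by rewrite !mulr_ge0// ?(ltW C0) ?(ltW th0)// (le_trans _ x1).
  by rewrite !exprMn r2 mulrA ler_pdivrMr.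
have tr : C * theta * r <= eps.
  have ct0 : 0 <= C * theta by rewrite mulr_ge0// ltW.
  by apply: le_trans main; rewrite ler_wpM2r// ler_peMr.
rewrite CE in main tr.
split; split=> //.
- by rewrite /s0; lra.
- by rewrite /K; lra.
- by rewrite /K /s0; lra.
- rewrite /K ler_pdivrMr//.
  have h1 : eps ^+ 2 * lambda <= lambda by rewrite ler_piMl// ltW.
  have : C ^+ 2 * theta ^+ 2 * x ^+ 2 * 2^-1 <= C ^+ 2 * theta ^+ 2 * x ^+ 2 * La.
    by rewrite ler_wpM2l// -mulrA mulr_ge0 ?exprn_ge0//; lra.
  have -> : theta ^+ 2 * (16 * x) ^+ 2 = 16 * 16 * (theta ^+ 2 * x ^+ 2) by ring.
  have C512 : 32 * 32 <= C ^+ 2 by rewrite CE; lra.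
  have := ler_wpM2r (le_trans ler01 tx1) C512.
  rewrite -[C ^+ 2 * _ * _]mulrA; lra.
(* The exponential is thus [(eps / n%:R) ^+ 4]: one factor absorbs d, because d < n, and the other
   three, each at most 1 / 4, absorb the constants. *)
- have -> : lambda * s0 ^+ 2 = 4%:R * La.
    by rewrite /s0 exprMn r2; field; rewrite gt_eqF.
  have -> : expR (- (4%:R * La)) = (eps / n%:R) ^+ 4.
    rewrite -mulrN expRM_natl expRN /La lnK ?posrE// invf_div//.
  set y := eps / n%:R.
  have y0 : 0 <= y by rewrite divr_ge0// ltW.
  have y4 : y <= 4^-1 by rewrite /y ler_pdivrMr//; lra.
  have dy : d%:R * y <= eps.
    rewrite /y mulrA ler_pdivrMr// mulrC ler_wpM2l ?(ltW e0)// ler_nat ltnW//.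
  have y3 : y ^+ 3 <= 64^-1.
    have -> : 64^-1 = 4^-1 ^+ 3 :> R by field.
    by rewrite lerXn2r ?nnegrE.
  have -> : 10 * d%:R * y ^+ 4 = 10 * ((d%:R * y) * y ^+ 3) by ring.
  have : (d%:R * y) * y ^+ 3 <= eps * 64^-1.
    have dy0 : 0 <= d%:R * y by rewrite mulr_ge0.
    have y30 : 0 <= y ^+ 3 by rewrite exprn_ge0.
    exact: ler_pM.
  lra.
(* The part in d cancels [2 ^+ d], and the part in L leaves [eps ^+ 4]. *)
- have -> : - (K / 4) = d%:R * (- 4) + 4%:R * (- L) by rewrite /K /x; field.
  rewrite expRD !expRM_natl.
  have -> : expR (- L) = eps by rewrite expRN /L lnK ?posrE ?divr_gt0// div1r invrK.
  have h5 : 2 * expR (- 4) <= 1 :> R.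
    rewrite expRN ler_pdivrMr ?expR_gt0// mul1r.
    have := @expR_ge1Dx R 4; lra.
  have h6 : 2 ^+ d * expR (- 4) ^+ d <= 1 :> R.
    by rewrite -exprMn exprn_ile1// mulr_ge0 ?expR_ge0.
  have e3 : eps ^+ 3 <= 8^-1.
    have -> : 8^-1 = 2^-1 ^+ 3 :> R by field.
    by rewrite lerXn2r ?nnegrE ?(ltW e0).
  have e4 : eps ^+ 4 <= eps / 8 by rewrite exprS ler_wpM2l// ltW.
  have e40 : 0 <= eps ^+ 4 by rewrite exprn_ge0// ltW.
  have := ler_wpM2r e40 h6; lra.
Qed.

End Constants.

Theorem theorem2p4 (R : realType) :
  exists2 gamma : R, 0 < gamma &
  forall (d n : nat) (A : 'M[int]_(d, n)) (b : 'cV[int]_d)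
    (z : 'cV[R]_n) (Y : 'I_d -> {fset 'cV[int]_n})
    (lambda rho theta alpha : R),
  let P : set 'cV[R]_n := polyhedron A b in
  let B : 'M[R]_(d, n) := scaledmx A z in
  \rank (mxR A : 'M[R]_(d, n)) = d ->
  (d < n)%N ->
  bounded_set P ->
  (exists2 x, P x & forall j, 0 < x j 0) ->
  range (fun x : 'cV[int]_n => A *m x) = [set: 'cV[int]_d] ->
  maximizes entropy P z ->
  (forall i, Y i != fset0) ->
  (forall i y, y \in Y i -> A *m y = delta_mx i 0) ->
  0 <= lambda ->
  (forall t : 'cV[R]_d, lambda * enorm t ^+ 2 <= qform A z t) ->
  0 < rho ->
  (forall i (x : 'cV[R]_n), psi (Y i) x <= rho * enorm x ^+ 2) ->
  1 <= theta ->
  (forall j, norm1 (col j (mxR A))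
               <= theta * Num.sqrt (z j 0 / (1 + z j 0) ^+ 3)) ->
  0 <= alpha ->
  (forall j, alpha <= z j 0 * (1 + z j 0)) ->
  forall epsilon : R, 0 < epsilon -> epsilon <= 1 / 2 ->
  gamma * epsilon ^- 2 * theta ^+ 2 * (d%:R + ln (1 / epsilon)) ^+ 2
    * ln (n%:R / epsilon) <= lambda ->
  let m : int := Num.floor (1 / (16 * pi ^+ 2 * rho * theta ^+ 2)) in
  exists kappa Delta : R,
    [/\ (nb_int_points P)%:R
          = expR (entropy z)
            * (kappa / ((2 * pi) `^ (d%:R / 2) * Num.sqrt (\det (B *m B^T)))
               + Delta),
        1 - epsilon <= kappa <= 1 + epsilon
      & `|Delta| <= (1 + 2 / 5 * alpha * pi ^+ 2) ^ (- m)].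
Proof.
exists ((16 * 16 * 8) ^+ 2) => [|d n A b z Y lambda rho theta alpha P B _ dn bndP _ _ zmax
  Y0 AY _ lamq rho0 hpsi th1 Ath al0 hal eps e0 e12 hlam m]; first by rewrite exprn_gt0// !mulr_gt0.
have e1 : eps <= 2^-1 by rewrite -div1r.
have Pz : P z := zmax.1.
have z0 j : 0 <= z j 0 := Pz.2 j.
(* If [z j 0] were 0, the bound on the l1 norm of a_j would force a_j = 0, against boundedness of
   P. *)
have zpos j : 0 < z j 0.
  rewrite lt_neqAle z0 andbT eq_sym; apply/negP => /eqP zj.
  have /eqP := bounded_polyhedron_col_neq0 j bndP Pz; apply.
  have := Ath j; rewrite zj mul0r sqrtr0 mulr0 => h.
  apply/matrixP => i k; rewrite ord1 [RHS]mxE; apply/eqP; rewrite -normr_le0.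
  apply: le_trans h; rewrite /norm1 (bigD1 i)//= lerDl.
  by apply: sumr_ge0.
(* For d = 0 the columns of A are empty, hence zero, while n > 0. *)
have d0 : (0 < d)%N.
  rewrite lt0n; apply/eqP => dz.
  have n0 : (0 < n)%N by exact: leq_ltn_trans dn.
  have /eqP := bounded_polyhedron_col_neq0 (Ordinal n0) bndP Pz; apply.
  by apply/matrixP => i; have := ltn_ord i; rewrite [X in (_ < X)%N]dz.
have [[lam0 ths0 K0] [Ks0 KL t1 t2]] := parameter_bounds erefl d0 dn e0 e1 th1 hlam.
have D0 : 0 <= (1 + 2 / 5 * alpha * pi ^+ 2) ^ (- m).
  by rewrite exprz_ge0// addr_ge0// !mulr_ge0// pi_ge0.
have hD (t : 'cV[R]_d) i : `|t i 0| <= pi -> 1 / (2 * theta) <= `|t i 0| ->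
  Normc.normc (charfun (fun j => z j 0) (fun j => dotv (col j (mxR A)) t)) <=
  (1 + 2 / 5 * alpha * pi ^+ 2) ^ (- m).
  move=> tpi tth.
  exact: (charfun_outer z0 (Y0 i) (AY i) rho0 (hpsi i) th1 al0 hal tpi tth).
have s0 : 0 <= 2 * Num.sqrt (ln (n%:R / eps) / lambda) by rewrite mulr_ge0.
have := mass_estimate bndP zmax zpos d0 lam0 lamq th1 Ath e0 e1 s0 ths0 K0 Ks0 KL D0 hD t1 t2.
have [det0 _] := gauss_esum_near (posdef_scaledmx zpos lam0 lamq).
rewrite gauss_massE// -/B.
set G0 := 1 / _; set mass := _ * expR _; set D := _ ^ _.
have p0 : 0 < (2 * pi) ^+ d :> R by rewrite exprn_gt0// mulr_gt0// pi_gt0.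
(* The inversion and [gauss_mass] both carry the factor [(2 * pi) ^+ d], which cancels. *)
rewrite [eps * _]mulrCA -mulrBr -mulrDr normrM (gtr0_norm p0) ler_pM2l// => est.
have pi2 : 0 < 2 * pi :> R by rewrite mulr_gt0// pi_gt0.
have G00 : 0 < G0.
  by apply: divr_gt0 => //; apply: mulr_gt0; [exact: powR_gt0|rewrite sqrtr_gt0].
have [kappa [Delta [e hk hDel]]] := mass_error_split G00 (ltW e0) D0 est.
exists kappa, Delta; split=> //.
have -> : kappa / ((2 * pi) `^ (d%:R / 2) * Num.sqrt (\det (B *m B^T))) = kappa * G0.
  by rewrite /G0 div1r.
by rewrite -e /mass mulrCA -expRD subrr expR0 mulr1.
Qed.
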